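(* Fix $n,m,d_1,d_2\in\mathbb{N}$ with $\frac{n}{d_1}\in\mathbb{N}$ and $\frac{m}{d_2}\ge\frac{n}{d_1}$. Let $\mathcal{C}$ be the class of all $n\times m$ random matrices $X$ with entries $X_{ij}=b_{ij}\xi_{ij}$, where $b_{ij}\ge 0$ are scalars and $\xi_{ij}$ ($i\le n$, $j\le m$) are independent, symmetrically distributed real random variables with $\mathbf{E}[\xi_{ij}^{2p}]\le \mathbf{E}[g^{2p}]$ for all $i,j$ and all $p\in\mathbb{N}$ (here $g\sim N(0,1)$), such that $$\max_{i\le n,\,j\le m} b_{ij}^2=1,\qquad \max_{j\le m}\sum_{i\le n} b_{ij}^2\le d_1,\qquad \max_{i\le n}\sum_{j\le m} b_{ij}^2\le d_2.$$ Then among all $X\in\mathcal{C}$, the unnormalized moments $\mathbf{E}[\mathrm{Tr}\,(XX^* )^p]$ are maximized, simultaneously for all $p\in\mathbb{N}$, by the $n\times m$ block-diagonal matrix $\tilde Y$ whose blocks have dimension $d_1\times d_2$ and i.i.d. $N(0,1)$ entries. That is, $\tilde Y\in\mathcal{C}$ and $$\mathbf{E}[\mathrm{Tr}\,(XX^* )^p]\le \mathbf{E}[\mathrm{Tr}\,(\tilde Y\tilde Y^* )^p]\quad\text{for all }X\in\mathcal{C},\ p\in\mathbb{N}.$$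
   Context: $\mathrm{Tr}\,M$ denotes the (unnormalized) trace $\sum_i M_{ii}$ of a square matrix, and $M^*$ the adjoint. The block-diagonal matrix $\tilde Y$ has $K=n/d_1$ blocks: for $k=1,\ldots,K$, the $k$-th block occupies rows $(k-1)d_1+1,\ldots,kd_1$ and columns $(k-1)d_2+1,\ldots,kd_2$; all entries in the blocks are independent $N(0,1)$ variables, and all entries outside the blocks (including all columns with index greater than $Kd_2$, if any) are zero. ''Symmetrically distributed'' means that $\xi_{ij}$ and $-\xi_{ij}$ have the same law. *)

(* Defs.v *)
From HB Require Import structures.
From mathcomp Require Import all_boot all_order all_algebra.
From mathcomp Require Import all_classical all_reals all_analysis.

Set Implicit Arguments.
Unset Strict Implicit.
Unset Printing Implicit Defensive.

Import Order.TTheory GRing.Theory Num.Theory.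
Import numFieldNormedType.Exports.

Local Open Scope classical_set_scope.
Local Open Scope ring_scope.

Definition independent_family d (T : measurableType d) (R : realType)
    (P : probability T R) (I : finType) (D : {set I})
    (X : I -> {RV P >-> R}) : Prop :=
  forall (J : {set I}) (A : I -> set R),
    J \subset D -> (forall i, measurable (A i)) ->
    P (\bigcap_(i in [set` J]) (X i @^-1` A i)) =
      (\prod_(i in J) P (X i @^-1` A i))%E.

(* Laws are compared on measurable sets only, since measures are total set
   functions whose values off the sigma-algebra are irrelevant. *)
Definition symmetric_rv d (T : measurableType d) (R : realType)
    (P : probability T R) (X : {RV P >-> R}) : Prop :=
  forall A : set R, measurable A -> P (X @^-1` A) = P ((fun w => - X w) @^-1` A).

(* The second parameter of [normal_prob] is the standard deviation. *)
Definition std_normal_rv d (T : measurableType d) (R : realType)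
    (P : probability T R) (X : {RV P >-> R}) : Prop :=
  forall A : set R, measurable A -> distribution P X A = normal_prob 0 1 A.

Definition std_normal_moment (R : realType) (k : nat) : \bar R :=
  'E_(normal_prob (0 : R) 1)[fun x : R => (x ^+ k)%R].

(* The entries of a matrix are real, so its adjoint is its transpose. *)
Definition trace_moment d (T : measurableType d) (R : realType)
    (P : probability T R) (n m : nat) (X : T -> 'M[R]_(n, m)) (p : nat) : \bar R :=
  'E_P[fun w => (\tr ((X w *m (X w)^T) ^+ p))%R].

(* The maxima are taken over families of nonnegative reals, so starting the
   iterated maximum at 0 does not affect their value. *)
Definition in_class d (T : measurableType d) (R : realType)
    (P : probability T R) (n m d1 d2 : nat) (X : T -> 'M[R]_(n, m)) : Prop :=
  exists (b : 'M[R]_(n, m)) (xi : 'I_n -> 'I_m -> {RV P >-> R}),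
    [/\ forall w, X w = \matrix_(i, j) (b i j * xi i j w),
        forall i j, 0 <= b i j,
        [/\ independent_family [set: 'I_n * 'I_m] (fun ij => xi ij.1 ij.2),
            forall i j, symmetric_rv (xi i j)
          & forall i j p,
              ('E_P[fun w => (xi i j w ^+ (2 * p))%R] <=
                 std_normal_moment R (2 * p))%E]
      & [/\ \big[Num.max/0]_(ij : 'I_n * 'I_m) b ij.1 ij.2 ^+ 2 = 1,
            \big[Num.max/0]_(j < m) \sum_(i < n) b i j ^+ 2 <= d1%:R
          & \big[Num.max/0]_(i < n) \sum_(j < m) b i j ^+ 2 <= d2%:R]].

(* Rows and columns are numbered from 0, and so are the n / d1 blocks. *)
Definition in_block (n m d1 d2 : nat) (i : 'I_n) (j : 'I_m) : bool :=
  [exists k : 'I_(n %/ d1),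
     (k * d1 <= i < k.+1 * d1)%N && (k * d2 <= j < k.+1 * d2)%N].

(* [g i j] is unconstrained for (i, j) outside the blocks, where it is unused. *)
Definition block_gaussian d (T : measurableType d) (R : realType)
    (P : probability T R) (n m d1 d2 : nat) (Y : T -> 'M[R]_(n, m)) : Prop :=
  exists g : 'I_n -> 'I_m -> {RV P >-> R},
    [/\ forall w, Y w = \matrix_(i, j) (if in_block d1 d2 i j then g i j w else 0),
        independent_family [set ij | in_block d1 d2 ij.1 ij.2]
          (fun ij : 'I_n * 'I_m => g ij.1 ij.2)
      & forall i j, in_block d1 d2 i j -> std_normal_rv (g i j)].

(* Main.v *)
Require Import Defs.
From mathcomp Require Import all_boot all_order all_algebra.
From mathcomp Require Import all_classical all_reals all_analysis.
From mathcomp Require Import measurable_realfun lra ring.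

(** The trace of (X X^T)^p is a sum over closed walks of length 2p in the
complete bipartite graph between rows and columns, each walk contributing the
product of the entries on its edges (trace_walks).  By independence
(expectation_prod) the expectation of such a product is a product over edges e
of b_e^k E[xi_e^k], where k counts the traversals of e.  Odd moments vanish by
symmetry and even ones are at most the Gaussian ones, so X only gains if it is
replaced by the Gaussian matrix with the same b (trace_moment_le_gaussian).

For Gaussian entries, E[g^(k+2)] = (k+1) E[g^k] is Wick's formula in recursive
form: a product of moments is the number of ways of matching the 2p steps of the
walk in pairs that traverse the same edge (wick_rec).  Unfolding it turns the
trace moment into a sum over perfect matchings of the steps, and the two matrices
can be compared matching by matching (walk_moment_le).  The labels of the walk
are only subject to the equalities imposed by the matching and never required to
be distinct; this is what makes the comparison exact, without correction terms.

Fix a matching.  Its equalities identify some of the positions 0, ..., 2p of the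
walk; call a position new if it is not forced to be equal to an earlier one.  The
steps that arrive at new positions belong to distinct pairs (not_both_new), so one
can keep the factor b^2 of each of these pairs and bound the other factors by 1.
Sum over the positions from the last one to the first: an old position offers one
choice, a new one contributes a row sum or a column sum of the b^2, hence at most
d2 or d1, and the starting row contributes n (pairing_sum_le).  For the
block-diagonal matrix nothing is lost: a walk never leaves the block of its
starting row, all its weights are 1, and a new position has exactly d2 or d1
choices (pairing_sum_ge).

The law of the block-diagonal matrix is realised on a product of normal lines
(exists_iid_normals), and the matrix is in the class once null variables are put
outside the blocks (block_in_class). *)

Set Implicit Arguments.
Unset Strict Implicit.
Unset Printing Implicit Defensive.

Import Order.TTheory GRing.Theory Num.Theory.
Import numFieldNormedType.Exports.
Local Open Scope ring_scope.

(** * Sums over words with prefix weights, and Wick's recursion *)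

Section words.
Variables (R : realDomainType) (V : finType).

Fixpoint words (N : nat) : seq (seq V) :=
  if N is N'.+1 then [seq rcons s y | s <- words N', y <- enum V] else [:: [::]].

Lemma size_words N s : s \in words N -> size s = N.
Proof.
elim: N s => [|N IH] s /=; first by rewrite inE => /eqP ->.
by move=> /allpairsP[[t y] /= [/IH <- _ ->]]; rewrite size_rcons.
Qed.

Lemma sum_words0 (f : seq V -> R) : \sum_(s <- words 0) f s = f [::].
Proof. by rewrite /= big_seq1. Qed.

Lemma sum_wordsS N (f : seq V -> R) :
  \sum_(s <- words N.+1) f s = \sum_(s <- words N) \sum_y f (rcons s y).
Proof.
rewrite /= big_allpairs_dep; apply: eq_bigr => s _.
by rewrite big_enum.
Qed.

(** Weights of this form can be summed over all words by summing over the last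
letter first. *)
Definition prefix_weight (phi : seq V -> R) (s : seq V) : R :=
  \prod_(k < size s) phi (take k.+1 s).

Lemma prefix_weight_rcons phi s y :
  prefix_weight phi (rcons s y) = prefix_weight phi s * phi (rcons s y).
Proof.
rewrite /prefix_weight size_rcons big_ord_recr/= take_oversize ?size_rcons//.
congr (_ * _); apply: eq_bigr => k _; congr (phi _).
by rewrite -cats1 takel_cat// ltn_ord.
Qed.

Lemma prefix_weight_ge0 phi s : (forall s, 0 <= phi s) -> 0 <= prefix_weight phi s.
Proof. by move=> phi0; apply: prodr_ge0. Qed.

Lemma sum_prefix_weight_le phi (D : nat -> R) N : (forall s, 0 <= phi s) ->
  (forall k, 0 <= D k) ->
  (forall s, (size s < N)%N -> \sum_y phi (rcons s y) <= D (size s)) ->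
  \sum_(s <- words N) prefix_weight phi s <= \prod_(k < N) D k.
Proof.
move=> phi0 D0; elim: N => [|N IH] H.
  by rewrite sum_words0 /prefix_weight !big_ord0.
rewrite sum_wordsS big_ord_recr/=.
apply: (@le_trans _ _ (\sum_(s <- words N) prefix_weight phi s * D N)).
  rewrite big_seq [leRHS]big_seq; apply: ler_sum => s /size_words sN.
  under eq_bigr do rewrite prefix_weight_rcons.
  rewrite -mulr_sumr ler_wpM2l ?prefix_weight_ge0// -sN H// sN//.
rewrite -mulr_suml ler_wpM2r//; apply: IH => s sN; apply: H.
exact: ltnW.
Qed.

Lemma sum_prefix_weight_ge phi (D : nat -> R) N : (forall s, 0 <= phi s) ->
  (forall k, 0 <= D k) ->
  (forall s, (size s < N)%N -> prefix_weight phi s != 0 ->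
     D (size s) <= \sum_y phi (rcons s y)) ->
  \prod_(k < N) D k <= \sum_(s <- words N) prefix_weight phi s.
Proof.
move=> phi0 D0; elim: N => [|N IH] H.
  by rewrite sum_words0 /prefix_weight !big_ord0.
rewrite sum_wordsS big_ord_recr/=.
apply: (@le_trans _ _ (\sum_(s <- words N) prefix_weight phi s * D N)).
  by rewrite -mulr_suml ler_wpM2r//; apply: IH => s sN; apply: H; exact: ltnW.
rewrite big_seq [leRHS]big_seq; apply: ler_sum => s /size_words sN.
under eq_bigr do rewrite prefix_weight_rcons.
rewrite -mulr_sumr; have [->|nz] := eqVneq (prefix_weight phi s) 0.
  by rewrite !mul0r.
by rewrite ler_wpM2l ?prefix_weight_ge0// -sN H// sN.
Qed.

End words.

Section wick.
Variables (R : realDomainType) (E : finType) (g : nat -> R).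
Hypotheses (g1 : g 1 = 0) (gS : forall k, g k.+2 = k.+1%:R * g k).

(** With g the moments of the standard normal law, this is the expectation of the
product of the variables listed in es, when distinct letters of es stand for
independent standard normal variables. *)
Definition product_moment (es : seq E) : R := \prod_e g (count_mem e es).

Lemma product_moment_cons (e : E) es :
  product_moment (e :: es) =
  g (count_mem e es).+1 * \prod_(f | f != e) g (count_mem f es).
Proof.
rewrite /product_moment (bigD1 e)//= eqxx add1n; congr (_ * _).
by apply: eq_bigr => f; rewrite eq_sym => /negbTE ->.
Qed.

(** Wick's formula, one step at a time: the position k of the list is matched with
any other position l that carries the same letter.  If the letter of k occurs c
more times in the list, the factor g (c + 1) = c g (c - 1) is spread over the c
possible partners. *)
Lemma wick_rec (T : eqType) (h : T -> E) (k : T) (t : seq T) :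
  product_moment (map h (k :: t)) =
  \sum_(l <- t) (h k == h l)%:R * product_moment (map h (rem l t)).
Proof.
rewrite map_cons product_moment_cons.
transitivity (\sum_(l <- t) (h k == h l)%:R *
    (g (count_mem (h k) (map h t)).-1 *
     \prod_(f | f != h k) g (count_mem f (map h t)))).
  rewrite -mulr_suml -natr_sum.
  rewrite (_ : (\sum_(l <- t) _)%N = count_mem (h k) (map h t)); last first.
    rewrite count_map -sum1_count [RHS]big_mkcond; apply: eq_bigr => l _ /=.
    by rewrite eq_sym; case: eqP.
  (* A letter without partner makes both sides vanish, as g 1 = 0. *)
  case: (count_mem _ _) => [|[|c]] /=; first by rewrite g1 !mul0r.
    by rewrite (gS 0) !mul1r.
  by rewrite gS mulrA.
rewrite big_seq [RHS]big_seq; apply: eq_bigr => l lt.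
have [hkl|] := eqVneq (h k) (h l); last by rewrite !mul0r.
have pt : perm_eq (map h t) (h l :: map h (rem l t)).
  by rewrite -map_cons perm_map// perm_to_rem.
congr (_ * _); rewrite /product_moment [RHS](bigD1 (h k))//=.
congr (g _ * _).
  by move/permP: pt => ->/=; rewrite hkl eqxx.
apply: eq_bigr => f fk; congr (g _).
by move/permP: pt => ->/=; rewrite -hkl eq_sym (negbTE fk).
Qed.

End wick.

(** * Closed walks whose steps are matched in pairs *)

(** Even positions of a walk are on the left side of the bipartite graph and odd
ones on the right side; edges are oriented from left to right, so that a step and
a step in the opposite direction can traverse the same edge. *)
Definition edge (V : Type) (f : nat -> V) (k : nat) : V * V :=
  if odd k then (f k.+1, f k) else (f k, f k.+1).

Section pairing.
Variables (R : realDomainType) (V : finType) (K : nat) (c : seq (nat * nat)).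
Hypothesis K_even : ~~ odd K.
Hypothesis c_perm : perm_eq (flatten [seq [:: q.1; q.2] | q <- c]) (iota 0 K).

Definition consistent (f : nat -> V) : bool :=
  (f K == f 0%N) && all (fun q => edge f q.1 == edge f q.2) c.

(** Quantifying over all consistent walks gives the equivalence relation generated
by the constraints, or a coarser one that has the same effect on labels in V,
without having to build a transitive closure. *)
Definition forced (k l : nat) : Prop := forall f, consistent f -> f k = f l.

Lemma ex_forced k : exists l, `[< forced l k >].
Proof. by exists k; apply/asboolP. Qed.

(** A position k is called new below when rep k = k. *)
Definition rep k : nat := ex_minn (ex_forced k).

Lemma rep_le k : (rep k <= k)%N.
Proof. by rewrite /rep; case: ex_minnP => l _; apply; apply/asboolP. Qed.

Lemma rep_forced k : forced (rep k) k.
Proof. by rewrite /rep; case: ex_minnP => l /asboolP. Qed.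

Lemma rep_min k l : forced l k -> (rep k <= l)%N.
Proof. by move=> lk; rewrite /rep; case: ex_minnP => j _; apply; apply/asboolP. Qed.

Lemma rep0 : rep 0 = 0%N. Proof. by apply/eqP; rewrite -leqn0 rep_le. Qed.

Lemma forced_rep k l : forced k l -> rep k = rep l.
Proof.
move=> kl; apply/eqP; rewrite eqn_leq; apply/andP; split; apply: rep_min => f cf.
  by rewrite rep_forced// kl.
by rewrite rep_forced// kl.
Qed.

Lemma big_pairs (T : Type) (idx : T) (op : Monoid.com_law idx) (F : nat -> T) :
  \big[op/idx]_(k < K) F k = \big[op/idx]_(q <- c) op (F q.1) (F q.2).
Proof.
rewrite -(big_mkord xpredT F) /index_iota subn0 -(perm_big _ c_perm) big_flatten.
by rewrite big_map; apply: eq_bigr => q _; rewrite !big_cons big_nil Monoid.mulm1.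
Qed.

Lemma pair_bounds q : q \in c -> [&& q.1 < K, q.2 < K & q.1 != q.2]%N.
Proof.
move=> qc; have mem k : k \in [:: q.1; q.2] -> (k < K)%N.
  move=> kq; have : k \in iota 0 K.
    by rewrite -(perm_mem c_perm); apply/flatten_mapP; exists q.
  by rewrite mem_iota.
rewrite !mem ?inE ?eqxx ?orbT//=; apply/eqP => q12.
have : uniq (flatten [seq [:: q.1; q.2] | q <- c]).
  by rewrite (perm_uniq c_perm) iota_uniq.
move/count_memPn: (qc); case/splitPr: c / qc => c1 c2 _.
by rewrite map_cat flatten_cat/= cat_uniq/= q12 inE eqxx/= !andbF.
Qed.

Lemma consistent_edge f q : consistent f -> q \in c -> edge f q.1 = edge f q.2.
Proof. by move=> /andP[_ /allP cf] /cf/eqP. Qed.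

(** The equalities with the representatives imply all constraints: forced
positions have the same representative. *)
Lemma consistent_rep f :
  (forall k, (k <= K)%N -> f k = f (rep k)) -> consistent f.
Proof.
move=> frep; have ff k l : (k <= K)%N -> (l <= K)%N -> forced k l -> f k = f l.
  by move=> kK lK /forced_rep kl; rewrite frep// kl -frep.
apply/andP; split.
  by apply/eqP/ff => // g /andP[/eqP].
apply/allP => q qc; have /and3P[q1 q2 _] := pair_bounds qc.
have := consistent_edge _ qc; rewrite /edge.
have := ltnW q1; have := ltnW q2 => q2' q1'.
by case: (odd q.1); case: (odd q.2) => E; apply/eqP; congr pair; apply: ff => // g /E[].
Qed.

(** Both ends of the later step of a pair are forced to be equal to ends of the
earlier one, so the later step cannot arrive at a new position. *)
Lemma not_both_new q : q \in c -> rep q.1.+1 = q.1.+1 -> rep q.2.+1 <> q.2.+1.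
Proof.
move=> qc; have /and3P[_ _ q12] := pair_bounds qc.
have same (f : nat -> V) (cf : consistent f) : edge f q.1 = edge f q.2.
  exact: consistent_edge.
have [lt|lt|/eqP] := ltngtP q.1 q.2; last by rewrite (negbTE q12).
  move=> _ new2; suff : (rep q.2.+1 <= q.1.+1)%N by rewrite new2 ltnS leqNgt lt.
  have [par|par] := eqVneq (odd q.1) (odd q.2).
    by apply: rep_min => f /same; rewrite /edge par; case: ifP => _ [].
  apply: leq_trans (leqnSn _); apply: rep_min => f /same; rewrite /edge.
  by move: par; case: (odd q.1); case: (odd q.2) => // _ [].
move=> new1 _; suff : (rep q.1.+1 <= q.2.+1)%N by rewrite new1 ltnS leqNgt lt.
have [par|par] := eqVneq (odd q.1) (odd q.2).
  by apply: rep_min => f /same; rewrite /edge par; case: ifP => _ [].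
apply: leq_trans (leqnSn _); apply: rep_min => f /same; rewrite /edge.
by move: par; case: (odd q.1); case: (odd q.2) => // _ [].
Qed.

(** Labels that only depend on the side are consistent, hence forced positions are
on the same side. *)
Lemma consistent_alternating (u v : V) :
  consistent (fun k => if odd k then v else u).
Proof.
rewrite /consistent (negbTE K_even) eqxx/=; apply/allP => q _; rewrite /edge/=.
by case: (odd q.1); case: (odd q.2).
Qed.

Lemma odd_rep (u v : V) k : u != v -> odd (rep k) = odd k.
Proof.
move=> uv; have := @rep_forced k _ (consistent_alternating u v).
by case: ifP; case: ifP => // _ _ /eqP; rewrite ?(negbTE uv)// eq_sym (negbTE uv).
Qed.

(** The weight of the step from k to k + 1 that is kept in the upper bound: the
full weight b^2 of its pair if it discovers a new position, and otherwise only
the constraint on the position where it arrives. *)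
Definition step_weight (b : V * V -> R) (f : nat -> V) (k : nat) : R :=
  if rep k.+1 == k.+1 then b (edge f k) ^+ 2 else (f k.+1 == f (rep k.+1))%:R.

Lemma step_weight_ge0 (b : V * V -> R) f k : 0 <= step_weight b f k.
Proof. by rewrite /step_weight; case: ifP => _; rewrite ?sqr_ge0 ?ler0n. Qed.

(** Each pair has total weight b^2; it is charged to its step that arrives at a new
position if there is one, and bounded by 1 otherwise. *)
Lemma consistent_prod_le (b : V * V -> R) f :
  (forall e, 0 <= b e) -> (forall e, b e <= 1) ->
  (consistent f)%:R * \prod_(k < K) b (edge f k) <= \prod_(k < K) step_weight b f k.
Proof.
move=> b0 b1; have [cf|] := boolP (consistent f); last first.
  by rewrite mul0r prodr_ge0// => k _; exact: step_weight_ge0.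
rewrite mul1r (big_pairs _ (fun k => b (edge f k))) (big_pairs _ (step_weight b f))/=.
rewrite big_seq [leRHS]big_seq.
apply: ler_prod => q qc; rewrite mulr_ge0//=.
have b2 e : b e ^+ 2 <= 1 by rewrite expr_le1.
have -> : edge f q.1 = edge f q.2 by exact: consistent_edge.
have := not_both_new qc; rewrite /step_weight -expr2 (consistent_edge cf qc).
rewrite -(@rep_forced q.1.+1 _ cf) -(@rep_forced q.2.+1 _ cf) !eqxx.
case: eqP => n1; case: eqP => n2 h; rewrite ?mulr1 ?mul1r//.
by case: (h n1).
Qed.

Section sums.
(* L is the left side; v0 only serves as the default value of nth. *)
Variables (v0 : V) (L : {set V}).

(** Since rep k.+1 <= k.+1, the weight of the step from k to k + 1 only depends on
the positions up to k + 1, as the summation of prefix weights requires. *)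
Definition prefix_step (b : V * V -> R) (s : seq V) : R :=
  match size s with
  | 0 => 1
  | 1 => (nth v0 s 0 \in L)%:R
  | k.+2 => step_weight b (nth v0 s) k
  end.

Lemma prefix_step_ge0 b s : 0 <= prefix_step b s.
Proof.
by rewrite /prefix_step; case: size => [|[|k]]//; exact: step_weight_ge0.
Qed.

Lemma prefix_step_take b s k : (k.+1 < size s)%N ->
  prefix_step b (take k.+2 s) = step_weight b (nth v0 s) k.
Proof.
move=> ks; rewrite /prefix_step size_takel// /step_weight /edge.
by rewrite !nth_take// ltnS rep_le.
Qed.

Lemma prefix_step_take0 b s : (0 < size s)%N ->
  prefix_step b (take 1 s) = (nth v0 s 0 \in L)%:R.
Proof. by move=> s0; rewrite /prefix_step size_takel// nth_take. Qed.

Lemma prefix_weightE b s : size s = K.+1 ->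
  prefix_weight (prefix_step b) s =
    (nth v0 s 0 \in L)%:R * \prod_(k < K) step_weight b (nth v0 s) k.
Proof.
move=> sK; rewrite /prefix_weight sK big_ord_recl prefix_step_take0 ?sK//.
by congr (_ * _); apply: eq_bigr => k _; rewrite prefix_step_take// sK ltnS ltn_ord.
Qed.

Definition pairing_sum (b : V * V -> R) : R :=
  \sum_(s <- words V K.+1) (nth v0 s 0 \in L)%:R *
     ((consistent (nth v0 s))%:R * \prod_(k < K) b (edge (nth v0 s) k)).

Variables (d1 d2 : nat).

(** Row sums of the b^2 are bounded by d2 and column sums by d1; the step that
arrives at position j + 1 leaves a left vertex when j is even. *)
Definition degree_bound (k : nat) : nat :=
  if k is j.+1 then
    if rep k == k then if odd j then d1 else d2 else 1
  else #|L|.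

(** Once the earlier positions are known, a new position contributes a row or column
sum of the b^2, and an old one is determined. *)
Lemma pairing_sum_le (b : V * V -> R) :
  (forall e, 0 <= b e) -> (forall e, b e <= 1) ->
  (forall u, \sum_v b (u, v) ^+ 2 <= d2%:R) ->
  (forall v, \sum_u b (u, v) ^+ 2 <= d1%:R) ->
  pairing_sum b <= \prod_(k < K.+1) (degree_bound k)%:R.
Proof.
move=> b0 b1 row col.
apply: (@le_trans _ _
    (\sum_(s <- words V K.+1) prefix_weight (prefix_step b) s)).
  rewrite /pairing_sum big_seq [leRHS]big_seq; apply: ler_sum => s /size_words sK.
  by rewrite prefix_weightE// ler_wpM2l ?ler0n// consistent_prod_le.
apply: (sum_prefix_weight_le (D := fun k => (degree_bound k)%:R)) => [||s _].
- exact: prefix_step_ge0.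
- by move=> k; rewrite ler0n.
rewrite /prefix_step/=.
have nthr y i : (i < size s)%N -> nth v0 (rcons s y) i = nth v0 s i.
  by move=> is_; rewrite nth_rcons is_.
have lastr y : nth v0 (rcons s y) (size s) = y by rewrite nth_rcons ltnn eqxx.
under eq_bigr do rewrite size_rcons.
case sE : (size s) => [|k] /=.
  rewrite -sum1_card natr_sum [leRHS]big_mkcond/= ler_sum// => y _.
  by rewrite -[in nth v0 (rcons s y) 0]sE lastr; case: ifP.
rewrite sE in nthr lastr; rewrite /step_weight; case: ifP => [new|old].
  rewrite /edge; case: (odd k).
    by apply: le_trans (col (nth v0 s k)); apply: ler_sum => y _; rewrite lastr nthr.
  by apply: le_trans (row (nth v0 s k)); apply: ler_sum => y _; rewrite lastr nthr.
have rk : (rep k.+1 < k.+1)%N by rewrite ltn_neqAle old rep_le.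
under eq_bigr do rewrite lastr nthr//.
by rewrite (bigD1 (nth v0 s (rep k.+1)))//= eqxx big1 ?addr0// => y /negbTE ->.
Qed.

Variables (B : eqType) (blk : V -> B).

(** The weights of the disjoint union of the complete bipartite graphs between the
left and right vertices of each block. *)
Definition block_edge (e : V * V) : R :=
  [&& e.1 \in L, e.2 \notin L & blk e.1 == blk e.2]%:R.

Lemma block_edge_sqr e : block_edge e ^+ 2 = block_edge e.
Proof. by rewrite /block_edge -natrX; case: (_ && _). Qed.

Lemma prefix_step_neq0 b s k : prefix_weight (prefix_step b) s != 0 ->
  (k < size s)%N -> prefix_step b (take k.+1 s) != 0.
Proof. by move=> /prodf_neq0 h ks; exact: (h (Ordinal ks)). Qed.

(** A walk of nonzero weight never leaves the block where it starts: a new position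
is adjacent to the previous one, an old one repeats an earlier label. *)
Lemma block_walk (vL vR : V) s : vL \in L -> vR \notin L ->
  prefix_weight (prefix_step block_edge) s != 0 ->
  forall k, (k < size s)%N ->
    (nth v0 s k \in L) = ~~ odd k /\ blk (nth v0 s k) = blk (nth v0 s 0).
Proof.
move=> vLL vRL nz; elim/ltn_ind => -[|k] IH ks.
  have := prefix_step_neq0 nz ks; rewrite prefix_step_take0//.
  by case: (_ \in L); rewrite ?eqxx.
have := prefix_step_neq0 nz ks; rewrite prefix_step_take// /step_weight.
case: ifP => [_|old].
  rewrite block_edge_sqr /block_edge /edge.
  have [_ <-] := IH k (ltnSn _) (ltnW ks).
  case: ifP => /= ok; rewrite pnatr_eq0 eqb0 negbK => /and3P[kL k1L /eqP kb].
    by rewrite kL kb ok.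
  by rewrite (negbTE k1L) kb ok.
have rk : (rep k.+1 < k.+1)%N by rewrite ltn_neqAle old rep_le.
have [rL rb] := IH _ rk (ltn_trans rk ks).
rewrite pnatr_eq0 eqb0 negbK => /eqP ->.
rewrite rL rb (@odd_rep vL vR)//.
by apply: contraNneq vRL => <-.
Qed.

(** Prefixes of nonzero weight extend in at least as many ways as the degree bound
says, and a complete word of nonzero weight is a consistent walk all of whose
edges have weight 1. *)
Lemma pairing_sum_ge :
  (exists v, v \notin L) ->
  (forall r, r \in L -> (d2 <= #|[set v | (v \notin L) && (blk v == blk r)]|)%N) ->
  (forall r, r \in L -> (d1 <= #|[set u in L | blk u == blk r]|)%N) ->
  \prod_(k < K.+1) (degree_bound k)%:R <= pairing_sum block_edge.
Proof.
move=> [vR vRL] row col.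
apply: (@le_trans _ _
    (\sum_(s <- words V K.+1) prefix_weight (prefix_step block_edge) s)).
  apply: (sum_prefix_weight_ge (D := fun k => (degree_bound k)%:R)) => [||s _ nz].
  - exact: prefix_step_ge0.
  - by move=> k; rewrite ler0n.
  rewrite /prefix_step/=.
  have nthr y i : (i < size s)%N -> nth v0 (rcons s y) i = nth v0 s i.
    by move=> is_; rewrite nth_rcons is_.
  have lastr y : nth v0 (rcons s y) (size s) = y by rewrite nth_rcons ltnn eqxx.
  under eq_bigr do rewrite size_rcons.
  case sE : (size s) => [|k] /=.
    rewrite -sum1_card natr_sum [leLHS]big_mkcond/= ler_sum// => y _.
    by rewrite -[in nth v0 (rcons s y) 0]sE lastr; case: ifP.
  rewrite sE in nthr lastr; rewrite /step_weight; case: ifP => [new|old].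
    have s0L : nth v0 s 0 \in L.
      have := prefix_step_neq0 nz (k := 0); rewrite sE prefix_step_take0 ?sE//.
      by case: (_ \in L) => //; rewrite eqxx => /(_ isT).
    have [kL kb] := block_walk s0L vRL nz (k := k) (eq_leq (esym sE)).
    under eq_bigr do rewrite block_edge_sqr.
    rewrite /edge /block_edge; case: ifP kL => ok /= kL.
      apply: (@le_trans _ _ #|[set u in L | blk u == blk (nth v0 s 0)]|%:R).
        by rewrite ler_nat col.
      rewrite -sum1_card natr_sum big_mkcond/= ler_sum// => y _.
      by rewrite lastr nthr// kL kb inE andTb; case: ifP.
    apply: (@le_trans _ _ #|[set v | (v \notin L) && (blk v == blk (nth v0 s 0))]|%:R).
      by rewrite ler_nat row.
    rewrite -sum1_card natr_sum big_mkcond/= ler_sum// => y _.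
    by rewrite lastr nthr// kL kb inE andTb eq_sym; case: ifP.
  have rk : (rep k.+1 < k.+1)%N by rewrite ltn_neqAle old rep_le.
  under eq_bigr do rewrite lastr nthr//.
  by rewrite (bigD1 (nth v0 s (rep k.+1)))//= eqxx lerDl sumr_ge0.
rewrite /pairing_sum big_seq [leRHS]big_seq; apply: ler_sum => s /size_words sK.
have [->|nz] := eqVneq (prefix_weight (prefix_step block_edge) s) 0.
  by rewrite !mulr_ge0// prodr_ge0.
have s0L : nth v0 s 0 \in L.
  have := prefix_step_neq0 nz (k := 0); rewrite sK prefix_step_take0 ?sK//.
  by case: (_ \in L) => //; rewrite eqxx => /(_ isT).
have walk := block_walk s0L vRL nz; rewrite sK in walk.
have -> : consistent (nth v0 s).
  apply: consistent_rep => -[_|k kK]; first by rewrite rep0.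
  have := prefix_step_neq0 nz (k := k.+1); rewrite sK ltnS => /(_ kK).
  rewrite prefix_step_take ?sK// /step_weight; case: ifP => [/eqP ->//|_].
  by rewrite pnatr_eq0 eqb0 negbK => /eqP.
rewrite prefix_weightE// s0L !mul1r.
have be1 e : block_edge e <= 1 by rewrite /block_edge lern1 leq_b1.
rewrite [leRHS]big1 => [|k _].
  apply: prodr_ile1 => k _; rewrite step_weight_ge0/= /step_weight.
  by case: ifP => _; rewrite ?block_edge_sqr// lern1 leq_b1.
have [[kL kb] [k1L k1b]] := (walk k (ltnW (ltn_ord k)), walk k.+1 (ltn_ord k)).
rewrite /block_edge /edge; case: ifP => /= ok; rewrite kL k1L kb k1b eqxx /= ok//.
Qed.

End sums.
End pairing.

(** * Comparison of closed walk sums *)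

Section closed_walks.
Variables (R : realDomainType) (V : finType) (v0 : V) (L : {set V}).
Variable (g : nat -> R).
Hypotheses (g0 : g 0 = 1) (g1 : g 1 = 0) (gS : forall k, g k.+2 = k.+1%:R * g k).

(** Partially expanded form of a Gaussian trace moment: the steps in t still await
their partners, and c lists the pairs formed so far. *)
Definition walk_moment (K : nat) (b : V * V -> R) (t : seq nat) (c : seq (nat * nat)) : R :=
  \sum_(s <- words V K.+1) (nth v0 s 0 \in L)%:R *
    ((consistent K c (nth v0 s))%:R * \prod_(k < K) b (edge (nth v0 s) k) *
     product_moment g [seq edge (nth v0 s) k | k <- t]).

Lemma walk_moment_nil K b c : walk_moment K b [::] c = pairing_sum K c v0 L b.
Proof.
apply: eq_bigr => s _; congr (_ * _).
by rewrite /product_moment/= [X in _ * X]big1 ?mulr1.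
Qed.

Lemma walk_moment_cons K b k t c :
  walk_moment K b (k :: t) c = \sum_(l <- t) walk_moment K b (rem l t) ((k, l) :: c).
Proof.
rewrite /walk_moment exchange_big/=; apply: eq_bigr => s _.
rewrite -mulr_sumr; congr (_ * _); rewrite (wick_rec g1 gS) mulr_sumr.
apply: eq_bigr => l _; rewrite /consistent/= andbCA -!mulnb !natrM.
ring.
Qed.

Variables (d1 d2 : nat) (b : V * V -> R) (B : eqType) (blk : V -> B).
Hypotheses (b_ge0 : forall e, 0 <= b e) (b_le1 : forall e, b e <= 1).
Hypothesis b_row : forall u, \sum_v b (u, v) ^+ 2 <= d2%:R.
Hypothesis b_col : forall v, \sum_u b (u, v) ^+ 2 <= d1%:R.
Hypothesis right_vertex : exists v, v \notin L.
Hypothesis blk_right : forall r, r \in L ->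
  (d2 <= #|[set v | (v \notin L) && (blk v == blk r)]|)%N.
Hypothesis blk_left : forall r, r \in L ->
  (d1 <= #|[set u in L | blk u == blk r]|)%N.

(** Both sides are expanded by the same recursion, which leads to the same perfect
matchings of the steps; for these the two bounds on pairing sums meet. *)
Lemma walk_moment_le K t c : ~~ odd K ->
  perm_eq (t ++ flatten [seq [:: q.1; q.2] | q <- c]) (iota 0 K) ->
  walk_moment K b t c <= walk_moment K (block_edge R L blk) t c.
Proof.
move=> K_even; elim: {t}_.+1 {-2}t (ltnSn (size t)) c => // N IH [|k t] tN c pt.
  rewrite !walk_moment_nil.
  exact: le_trans (pairing_sum_le pt v0 L b_ge0 b_le1 b_row b_col)
    (pairing_sum_ge R K_even pt v0 right_vertex blk_right blk_left).
rewrite !walk_moment_cons big_seq [leRHS]big_seq; apply: ler_sum => l lt.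
apply: IH; first by rewrite size_rem//; apply: leq_ltn_trans (leq_pred _) _.
rewrite -(permPr pt)/= -cat1s perm_catCA/= perm_cons.
rewrite perm_sym; apply: perm_trans (perm_cat (perm_to_rem lt) (perm_refl _)) _.
by rewrite /= -cat1s -[in X in perm_eq _ X]cat1s perm_sym perm_catCA.
Qed.

End closed_walks.

Local Open Scope classical_set_scope.
Local Open Scope ring_scope.

(** * Expectation of a product of independent random variables *)

Section weighted_change_of_variables.
Import HBNNSimple.
Local Open Scope ereal_scope.
Context d d' (T : measurableType d) (S : measurableType d') (R : realType).
Variables (mu : {measure set T -> \bar R}) (nu : {measure set S -> \bar R}).
Variables (U : T -> S) (Z : T -> R).
Hypotheses (mU : measurable_fun setT U) (mZ : measurable_fun setT Z).
Hypothesis Z0 : forall t, (0 <= Z t)%R.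
Hypothesis nuE : forall A, measurable A ->
  nu A = \int[mu]_t (\1_A (U t) * Z t)%:E.

Let integral_weighted_nnsfun (h : {nnsfun S >-> R}) :
  \int[nu]_x (h x)%:E = \int[mu]_t ((h (U t))%:E * (Z t)%:E).
Proof.
under [LHS]eq_integral do rewrite fimfunE -fsumEFin//.
rewrite ge0_integral_fsum//=; last 2 first.
  - by move=> r; exact/measurable_EFinP/measurableT_comp.
  - by move=> r x _; rewrite EFinM nnfun_muleindic_ge0.
have mind r : measurable_fun setT
    (fun t => (r * \1_(h @^-1` [set r]) (U t))%:E : \bar R).
  apply/measurable_EFinP/measurable_funM => //.
  exact: measurableT_comp.
under [RHS]eq_integral => t _.
  rewrite fimfunE -fsumEFin// ge0_mule_fsuml; last first.
    by move=> r; exact: nnfun_muleindic_ge0.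
  over.
rewrite [RHS]ge0_integral_fsum//=; last 2 first.
  - by move=> r; apply: emeasurable_funM => //; exact/measurable_EFinP.
  - by move=> r t _; rewrite mule_ge0 ?lee_fin//; exact: nnfun_muleindic_ge0.
apply: eq_fsbigr => r /[!inE] -[x0 _ r0].
under eq_integral do rewrite EFinM.
rewrite integralZl_indic_nnsfun//= integral_indic//= setIT nuE//.
rewrite -ge0_integralZl//.
- by apply: eq_integral => t _; rewrite EFinM muleA -EFinM.
- apply/measurable_EFinP/measurable_funM => //; exact: measurableT_comp.
- by move=> t _; rewrite lee_fin mulr_ge0.
- by rewrite lee_fin -r0.
Qed.

(** If nu is the image under U of the measure of density Z, then integrals against
nu are integrals weighted by Z.  It is used for densities on the line (U the
identity) and, in the induction below, for one factor of a product of independent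
variables (Z the product of the others). *)
Lemma integral_weighted (f : S -> \bar R) :
  measurable_fun setT f -> (forall x, 0 <= f x) ->
  \int[nu]_x f x = \int[mu]_t (f (U t) * (Z t)%:E).
Proof.
move=> mf f0; pose h := nnsfun_approx measurableT mf.
have fE x : (h n x)%:E @[n --> \oo] --> f x by exact: cvg_nnsfun_approx.
have hh x : {homo (fun n => (h n x)%:E) : m n / (m <= n)%N >-> m <= n}.
  by move=> m n mn; rewrite lee_fin; exact/lefP/nd_nnsfun_approx.
transitivity (limn (fun n => \int[nu]_x (h n x)%:E)).
  rewrite -monotone_convergence//=.
  - by apply: eq_integral => x _; apply/esym/cvg_lim.
  - by move=> n; exact/measurable_EFinP.
  - by move=> n x _; rewrite lee_fin.
transitivity (limn (fun n => \int[mu]_t ((h n (U t))%:E * (Z t)%:E))).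
  by apply: congr_lim; apply/funext => n; exact: integral_weighted_nnsfun.
rewrite -monotone_convergence//=.
- apply: eq_integral => t _; apply/cvg_lim => //.
  by apply: cvgeZr => //; exact: fE.
- move=> n; apply: emeasurable_funM; apply/measurable_EFinP => //.
  exact: measurableT_comp.
- by move=> n t _; rewrite mule_ge0// lee_fin.
- by move=> t _ m n mn; rewrite lee_wpmul2r ?lee_fin//; exact/lefP/nd_nnsfun_approx.
Qed.

End weighted_change_of_variables.

Section product_expectation.
Context d (T : measurableType d) (R : realType) (P : probability T R).
Variables (I : finType) (X : I -> {RV P >-> R}).
Hypothesis indepX : independent_family [set: I]%SET X.
Local Notation E f := (\int[P]_w (f w)%:E)%E.

Let integral_prod_indic (A : I -> set R) : (forall i, measurable (A i)) ->
  E (fun w => \prod_i \1_(A i) (X i w)) = (\prod_i E (fun w => \1_(A i) (X i w)))%E.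
Proof.
move=> mA.
have mX i : measurable (X i @^-1` A i) by exact: measurable_funPTI.
have indE i w : \1_(A i) (X i w) = \1_(X i @^-1` A i) w :> R.
  by rewrite !indicE; congr (_%:R); apply/idP/idP; rewrite !inE.
transitivity (P (\bigcap_(i in [set` [set: I]%SET]) (X i @^-1` A i))).
  rewrite -[in RHS](setIT (\bigcap_(i in _) _)) -integral_indic//; last first.
    by apply: fin_bigcap_measurable => //; exact: finite_finset.
  apply: eq_integral => w _; congr (_%:E).
  under eq_bigr do rewrite indE.
  rewrite [RHS]indicE; case: (boolP (w \in _)) => [|wA].
    rewrite inE => wA; rewrite big1// => i _; rewrite indicE mem_set//.
    by apply: wA; rewrite /= inE.
  apply/eqP; rewrite prodf_seq_eq0; apply: contraNT wA => /hasPn h.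
  rewrite inE => i _; have := h i; rewrite mem_index_enum => /(_ isT)/=.
  by rewrite indicE pnatr_eq0 eqb0 negbK inE.
rewrite (indepX (subxx _) mA); apply: eq_big => [i|i _]; first by rewrite inE.
by under eq_integral do rewrite indE; rewrite integral_indic// setIT.
Qed.

(** Independence is the case of indicator functions.  The indicators are replaced
by the functions f i one index at a time: as a function of the event tested at
index j, the expectation of the product is a multiple of the law of X j. *)
Lemma ge0_expectation_prod (f : I -> R -> R) :
  (forall i, measurable_fun setT (f i)) -> (forall i x, 0 <= f i x) ->
  (forall i, E (fun w => f i (X i w)) < +oo)%E ->
  E (fun w => \prod_i f i (X i w)) = (\prod_i E (fun w => f i (X i w)))%E.
Proof.
move=> mf f0 foo.
have EP0 A i : (0 <= E (fun w => f i (X i w)))%E.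
  by apply: integral_ge0 => w _; rewrite lee_fin.
suff H (r : seq I) (A : I -> set R) : uniq r -> (forall i, measurable (A i)) ->
  let h i := if i \in r then f i else \1_(A i) in
  E (fun w => \prod_i h i (X i w)) = (\prod_i E (fun w => h i (X i w)))%E.
  have := H (index_enum I) (fun=> setT) (index_enum_uniq _) (fun=> measurableT).
  move=> /= Hf; transitivity (E (fun w => \prod_i (if i \in index_enum I then f i
      else \1_[set: R]) (X i w))); last rewrite Hf.
    by apply: eq_integral => w _; congr EFin; apply: eq_bigr => i _; rewrite mem_index_enum.
  by apply: eq_bigr => i _; rewrite mem_index_enum.
elim: r A => [|j r IH] A /=; first by move=> _; exact: integral_prod_indic.
move=> /andP[jr ur] mA.
set h := fun i => if i \in j :: r then f i else \1_(A i).
have mh i : measurable_fun setT (h i).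
  by rewrite /h; case: ifP => // _; exact: measurable_indic.
have h0 i x : 0 <= h i x by rewrite /h; case: ifP => // _; rewrite indicE.
have hoo i : (E (fun w => h i (X i w)) < +oo)%E.
  rewrite /h; case: ifP => // _.
  apply: (@le_lt_trans _ _ (E (fun=> 1%R))); last first.
    by rewrite integral_cst//= probability_setT mule1 ltry.
  apply: ge0_le_integral => //.
  - by apply/measurable_EFinP/measurableT_comp => //; exact: measurable_indic.
  - by move=> w _; rewrite lee_fin indicE; case: (_ \in _).
pose Z w := \prod_(i | i != j) h i (X i w).
have Z0 w : 0 <= Z w by exact: prodr_ge0.
have mZ : measurable_fun setT Z.
  rewrite (_ : Z = fun w => \prod_i (if i != j then h i (X i w) else 1)); last first.
    by apply/funext => w; rewrite /Z big_mkcond.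
  apply: (@measurable_prod _ _ R setT _ _
    (fun i w => if i != j then h i (X i w) else 1)) => i _.
  by case: (i != j) => //; exact: measurableT_comp.
pose c := (\prod_(i | i != j) fine (E (fun w => h i (X i w)))).
have c0 : 0 <= c.
  by apply: prodr_ge0 => i _; apply/fine_ge0/integral_ge0 => w _; rewrite lee_fin.
have cE : (\prod_(i | i != j) E (fun w => h i (X i w)))%E = c%:E.
  rewrite -prodEFin; apply: eq_bigr => i _; rewrite fineK// ge0_fin_numE//.
  by apply: integral_ge0 => w _; rewrite lee_fin.
rewrite [RHS](bigD1 j)//= cE.
transitivity (\int[P]_w ((f j (X j w))%:E * (Z w)%:E))%E.
  apply: eq_integral => w _; rewrite (bigD1 j)//= -EFinM /h.
  by rewrite mem_head.
pose nu := mscale (NngNum c0) (distribution P (X j)).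
rewrite -(@integral_weighted _ _ _ _ _ P nu (X j) Z _ mZ Z0 _ (EFin \o f j)).
- rewrite ge0_integral_mscale//=; last 2 first.
  + exact/measurable_EFinP.
  + by move=> x _; rewrite lee_fin.
  rewrite ge0_integral_distribution//=; last 2 first.
  + exact/measurable_EFinP.
  + by move=> x; rewrite lee_fin.
  by rewrite muleC /h mem_head.
- exact: measurable_funPT.
- move=> B mB; pose A' i := if i == j then B else A i.
  have mA' i : measurable (A' i) by rewrite /A'; case: ifP.
  have /= IHB := IH A' ur mA'.
  transitivity (E (fun w => \prod_i (if i \in r then f i else \1_(A' i)) (X i w))).
    rewrite IHB (bigD1 j)//= (negbTE jr) {1}/A' eqxx.
    rewrite (_ : (\prod_(i | i != j) _)%E = c%:E); last first.
      rewrite -cE; apply: eq_bigr => i ij; rewrite /h inE (negbTE ij)/=.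
      by rewrite /A' (negbTE ij).
    rewrite /nu /mscale/= muleC; congr (_ * _)%E.
    under eq_integral => w _ do rewrite (_ : \1_B (X j w) = \1_(X j @^-1` B) w) ?indicE//.
    by rewrite integral_indic ?setIT//; exact: measurable_funPTI.
  apply: eq_integral => w _; rewrite (bigD1 j)//= (negbTE jr) {1}/A' eqxx.
  congr (_ * _)%:E; apply: eq_bigr => i ij; rewrite /h inE (negbTE ij)/=.
  by rewrite /A' (negbTE ij).
- exact/measurable_EFinP.
- by move=> x; rewrite lee_fin.
Qed.

(** Split each factor into its positive and negative parts and expand the product;
every term of the expansion is a signed product of nonnegative functions. *)
Lemma expectation_prod (f : I -> R -> R) :
  (forall i, measurable_fun setT (f i)) ->
  (forall i, P.-integrable setT (fun w => (f i (X i w))%:E)) ->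
  P.-integrable setT (fun w => (\prod_i f i (X i w))%:E) /\
  E (fun w => \prod_i f i (X i w)) = (\prod_i fine (E (fun w => f i (X i w))))%:E.
Proof.
move=> mf intf.
pose sg (u : bool) : R := if u then 1 else -1.
pose phi (u : bool) i x : R := Num.max (sg u * f i x) 0.
have mphi u i : measurable_fun setT (phi u i).
  by apply: measurable_maxr => //; exact: measurable_funM.
have phi0 u i x : 0 <= phi u i x by rewrite le_max lexx orbT.
have phif u i x : `|phi u i x| <= `|f i x|.
  rewrite ger0_norm// ge_max normr_ge0 andbT (le_trans (ler_norm _))// normrM.
  by rewrite /sg; case: u; rewrite ?normrN normr1 mul1r.
have fphi i x : f i x = \sum_u sg u * phi u i x.
  rewrite big_bool /phi /sg/= !mul1r !mulN1r.
  have [h|h] := leP 0 (f i x).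
    by rewrite max_r ?oppr_le0// subr0.
  by rewrite max_l ?oppr_ge0 ?ltW// opprK add0r.
have mphiX u i : measurable_fun setT (fun w => phi u i (X i w)) by exact: measurableT_comp.
have iphi u i : P.-integrable setT (fun w => (phi u i (X i w))%:E).
  apply: le_integrable (intf i) => //; first exact/measurable_EFinP.
  by move=> w _; rewrite /= lee_fin phif.
have Ephi u i : E (fun w => phi u i (X i w)) = (fine (E (fun w => phi u i (X i w))))%:E.
  by rewrite fineK// integrable_fin_num.
have prodE w : \prod_i f i (X i w) =
    \sum_(t : {ffun I -> bool}) (\prod_i sg (t i)) * \prod_i phi (t i) i (X i w).
  under eq_bigr do rewrite fphi.
  by rewrite bigA_distr_bigA; apply: eq_bigr => t _; rewrite big_split.
have Eprod (t : {ffun I -> bool}) : E (fun w => \prod_i phi (t i) i (X i w)) =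
    (\prod_i fine (E (fun w => phi (t i) i (X i w))))%:E.
  rewrite (ge0_expectation_prod (f := fun i => phi (t i) i))//.
    by rewrite -prodEFin; apply: eq_bigr => i _; exact: Ephi.
  by move=> i; rewrite Ephi ltry.
have iprod (t : {ffun I -> bool}) :
    P.-integrable setT (fun w => (\prod_i phi (t i) i (X i w))%:E).
  apply/integrableP; split.
    apply/measurable_EFinP.
    exact: (@measurable_prod _ _ R setT _ _ (fun i w => phi (t i) i (X i w))).
  under eq_integral => w _ do rewrite /= ger0_norm ?prodr_ge0//.
  by rewrite Eprod ltry.
have isum (t : {ffun I -> bool}) : P.-integrable setT
    (fun w => ((\prod_i sg (t i))%:E * (\prod_i phi (t i) i (X i w))%:E)%E).
  exact: integrableZl.
have prodEE : (fun w => (\prod_i f i (X i w))%:E) = (fun w =>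
    \sum_(t : {ffun I -> bool})
      ((\prod_i sg (t i))%:E * (\prod_i phi (t i) i (X i w))%:E)%E).
  by apply/funext => w; rewrite prodE -sumEFin.
split; first by rewrite prodEE; exact: integrable_sum.
rewrite prodEE integral_sum//.
rewrite (eq_bigr (fun t : {ffun I -> bool} =>
    (\prod_i (sg (t i) * fine (E (fun w => phi (t i) i (X i w)))))%:E)); last first.
  by move=> t _; rewrite (integralZl measurableT (iprod t)) Eprod -EFinM -big_split.
rewrite sumEFin -(bigA_distr_bigA (fun i u => sg u * fine (E (fun w => phi u i (X i w))))).
congr _%:E; apply: eq_bigr => i _.
rewrite [in RHS](_ : E (fun w => f i (X i w)) = \sum_u
    (\int[P]_w ((sg u)%:E * (phi u i (X i w))%:E))%E); last first.
  rewrite -integral_sum//; last by move=> u; exact: integrableZl.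
  by apply: eq_integral => w _; rewrite fphi -sumEFin.
under [in RHS]eq_bigr => u _ do rewrite (integralZl measurableT (iphi u i)) Ephi -EFinM.
by rewrite sumEFin.
Qed.

End product_expectation.

(** * Moments of the standard normal distribution *)

(** The moments of the standard normal law, given by their recursion. *)
Fixpoint gauss_moment (R : pzSemiRingType) (k : nat) : R :=
  match k with 0 => 1 | 1 => 0 | j.+2 => j.+1%:R * gauss_moment R j end.

Section gaussian_moments.
Variable R : realType.
Local Notation mu := (@lebesgue_measure R).

Definition gauss_pdf (x : R) : R := normal_pdf 0 1 x.

Lemma gauss_pdfE x : gauss_pdf x = normal_peak 1 * expR (- (x ^+ 2 / 2)).
Proof.
rewrite /gauss_pdf normal_pdfE ?oner_eq0// /normal_fun subr0 expr1n.
by rewrite mulNr.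
Qed.

Lemma gauss_pdf_ge0 x : 0 <= gauss_pdf x. Proof. exact: normal_pdf_ge0. Qed.

Lemma gauss_pdfN x : gauss_pdf (- x) = gauss_pdf x.
Proof. by rewrite !gauss_pdfE sqrrN. Qed.

Lemma continuous_gauss_pdf : continuous gauss_pdf.
Proof. by apply: continuous_normal_pdf; rewrite oner_eq0. Qed.

Lemma is_derive_gauss_pdf (x : R) : is_derive x 1 gauss_pdf (- (x * gauss_pdf x)).
Proof.
have -> : gauss_pdf = (fun x => normal_peak 1 * expR (- (x ^+ 2 / 2))).
  by apply/funext => y; exact: gauss_pdfE.
have dsq : is_derive x 1 (fun x : R => - (x ^+ 2 / 2)) (- x).
  by apply: is_derive_eq; rewrite /GRing.scale/=; field.
have dexp : is_derive x 1 (fun x : R => expR (- (x ^+ 2 / 2)))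
    (expR (- (x ^+ 2 / 2)) * - x).
  exact: (@is_derive1_comp _ expR).
have h := is_deriveZ (normal_peak (1 : R)) dexp.
refine (is_derive_eq h _).
by rewrite /GRing.scale/= !mulrN (mulrCA x) (mulrC x).
Qed.

(** The boundary term of the integration by parts below.  The exponential series
gives e^(x^2/2) >= (x^2/2)^(n+2) / (n+2)!, which beats x^(n+1) by a factor
larger than x. *)
Lemma cvg_pow_gauss_pdf n :
  (k%:R ^+ n.+1 * gauss_pdf k%:R : R) @[k --> \oo] --> (0 : R).
Proof.
(* The last factor 2 accounts for the shift in 1 / (k + 1). *)
pose c : R := normal_peak 1 * (2 ^+ n.+2 * (n.+2)`!%:R) * 2.
have peak0 : 0 <= normal_peak (1 : R) by exact: normal_peak_ge0.
have c0 : 0 <= c by rewrite /c; do !apply: mulr_ge0 => //; rewrite exprn_ge0.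
apply: (@squeeze_cvgr _ _ _ _ (fun=> 0) (fun k => c * (k.+1%:R)^-1)).
- apply: nearW => k; rewrite mulr_ge0 ?exprn_ge0 ?gauss_pdf_ge0//=.
  case: k => [|k]; first by rewrite expr0n mul0r divr_ge0.
  rewrite gauss_pdfE; set x : R := k.+1%:R.
  have x0 : 0 < x by rewrite ltr0n.
  have x1 : 1 <= x by rewrite ler1n.
  have /(expR_ge1Dxn n.+1) : 0 <= x ^+ 2 / 2 by rewrite divr_ge0// sqr_ge0.
  rewrite expRN; set e := expR _ => ge.
  have e0 : 0 < e by exact: expR_gt0.
  have f0 : 0 < (n.+2)`!%:R :> R by rewrite ltr0n fact_gt0.
  have {}ge : x ^+ n.+2 * x ^+ n.+2 <= e * (2 ^+ n.+2 * (n.+2)`!%:R).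
    rewrite -ler_pdivrMr; last by rewrite mulr_gt0// exprn_gt0.
    apply: le_trans ge; apply: le_trans (_ : (x ^+ 2 / 2) ^+ n.+2 / (n.+2)`!%:R <= _); last first.
      by rewrite lerDr.
    by rewrite exprMn -exprM mulnC exprM -expr2 exprVn -exprM mulnC exprM invfM mulrA.
  have xn : x ^+ n.+1 * (k.+2)%:R <= x ^+ n.+2 * x ^+ n.+2 * 2.
    have -> : k.+2%:R = x + 1 :> R by rewrite /x -natr1.
    apply: (@le_trans _ _ (x ^+ n.+1 * (x * 2))).
      by rewrite ler_wpM2l ?exprn_ge0 ?(ltW x0)// mulr_natr mulr2n lerD2l.
    rewrite mulrA -exprSr ler_wpM2r// ler_peMr ?exprn_ge0 ?(ltW x0)//.
    exact: exprn_ege1.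
  rewrite ler_pdivlMr ?ltr0n// /c -[leRHS]mulrA.
  rewrite [leLHS](_ : _ = normal_peak 1 * (x ^+ n.+1 * k.+2%:R / e)); last by ring.
  rewrite ler_wpM2l// ler_pdivrMr// (le_trans xn)// [leRHS]mulrAC ler_wpM2r//.
  by rewrite [leRHS]mulrC.
- exact: cvg_cst.
- rewrite -[X in _ --> X](mulr0 c); apply: cvgM; first exact: cvg_cst.
  exact: cvg_harmonic.
Qed.

Local Open Scope ereal_scope.

Lemma integral_normal_prob (f : R -> \bar R) :
  measurable_fun setT f -> (forall x, 0 <= f x) ->
  \int[normal_prob (0:R) 1]_x f x = \int[mu]_x (f x * (gauss_pdf x)%:E).
Proof.
move=> mf f0; apply: (@integral_weighted _ _ _ _ _ mu _ id gauss_pdf) => //.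
- exact: measurable_normal_pdf.
- exact: gauss_pdf_ge0.
move=> A mA; rewrite /normal_prob [LHS]integral_mkcond; apply: eq_integral => x _.
by rewrite patchE indicE; case: ifP => _; rewrite ?mul1r ?mul0r.
Qed.

(** The derivative of the density is - x times the density, so this is an
integration by parts on [0, N], followed by N -> oo. *)
Lemma half_gauss_moment_rec k :
  \int[mu]_(x in `[0%R, +oo[) (x ^+ (2 * k.+1) * gauss_pdf x)%:E =
  (2 * k).+1%:R%:E * \int[mu]_(x in `[0%R, +oo[) (x ^+ (2 * k) * gauss_pdf x)%:E.
Proof.
have ge0 j x : (0 <= x ^+ (2 * j) * gauss_pdf x)%R.
  by rewrite mulr_ge0 ?gauss_pdf_ge0// exprM exprn_ge0// sqr_ge0.
have cont j : continuous (fun x : R => x ^+ j * gauss_pdf x)%R.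
  by move=> x; apply: cvgM; [exact: exprn_continuous|exact: continuous_gauss_pdf].
have meas j : measurable_fun setT (fun x : R => x ^+ j * gauss_pdf x)%R.
  exact: continuous_measurable_fun.
have lim j := @ge0_cvgn_integral R mu _ (ge0 j) (meas _).
have parts n : \int[mu]_(x in `[0%R, n%:R]) (x ^+ (2 * k.+1) * gauss_pdf x)%:E =
    (2 * k).+1%:R%:E * \int[mu]_(x in `[0%R, n%:R]) (x ^+ (2 * k) * gauss_pdf x)%:E
    - (n%:R ^+ (2 * k).+1 * gauss_pdf n%:R)%:E.
  have [->|n0] := eqVneq n 0%N.
    by rewrite set_itv1 !integral_set1 mule0 expr0n mul0r sube0.
  have n_gt0 : (0 < n%:R :> R)%R by rewrite ltr0n lt0n.
  pose F (x : R) : R := (x ^+ (2 * k).+1)%R.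
  pose f (x : R) : R := ((2 * k).+1%:R * x ^+ (2 * k))%R.
  pose G (x : R) : R := (- gauss_pdf x)%R.
  pose g (x : R) : R := (x * gauss_pdf x)%R.
  have dF (x : R) : is_derive x 1%R F (f x).
    apply: DeriveDef; [exact: exprn_derivable|]. by rewrite exp_derive [LHS]mulr1.
  have dG (x : R) : is_derive x 1%R G (g x).
    have h := is_deriveN (is_derive_gauss_pdf x).
    by refine (is_derive_eq h _); rewrite opprK.
  have cF : continuous F by exact: exprn_continuous.
  have cG : continuous G by move=> x; apply: cvgN; exact: continuous_gauss_pdf.
  have LR (H : R -> R) h : (forall x : R, is_derive x 1%R H (h x)) -> continuous H ->
      derivable_oo_LRcontinuous H 0%R n%:R.
    by move=> dH cH; split=> [x _| |]; [exact: ex_derive|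
      apply: cvg_at_right_filter; exact: cH|
      apply: cvg_at_left_filter; exact: cH].
  have dE (H : R -> R) h : (forall x : R, is_derive x 1%R H (h x)) ->
      {in `]0%R, n%:R[, (H^`())%classic =1 h}.
    by move=> dH x _; rewrite derive1E derive_val.
  have cf : continuous f.
    by move=> x; apply: cvgM; [exact: cvg_cst|exact: exprn_continuous].
  have cg : continuous g by move=> x; apply: cvgM; [exact: cvg_id|exact: continuous_gauss_pdf].
  have := integration_by_parts n_gt0 (continuous_subspaceT cf) (LR _ _ dF cF)
    (dE _ _ dF) (continuous_subspaceT cg) (LR _ _ dG cG) (dE _ _ dG).
  under eq_integral do rewrite /F /g mulrA -exprSr -addn2 -[2%N]muln1 -mulnDr addn1.
  move=> ->; rewrite {2}/F expr0n mul0r subr0.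
  under eq_integral do rewrite /f /G mulrN -mulrA -mulNr EFinM.
  rewrite integralZl//=; last first.
    apply: continuous_compact_integrable; first exact: segment_compact.
    exact/continuous_subspaceT/cont.
  by rewrite EFinN mulNe oppeK addeC /F /G mulrN.
apply: (cvg_unique _ (lim k.+1)) => //.
rewrite (_ : (fun n => _) = (fun n =>
    (2 * k).+1%:R%:E * \int[mu]_(x in `[0%R, n%:R]) (x ^+ (2 * k) * gauss_pdf x)%:E
    - (n%:R ^+ (2 * k).+1 * gauss_pdf n%:R)%:E)); last exact/funext/parts.
rewrite -[X in _ X]sube0; apply: cvgeB.
- by rewrite fin_num_adde_defl// oppe0.
- by apply: cvgeZl => //; exact: lim.
- by apply/fine_cvgP; split; [exact: nearW|exact: cvg_pow_gauss_pdf].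
Qed.

End gaussian_moments.

Section normal_moments.
Variable R : realType.
Local Notation mu := (@lebesgue_measure R).
Local Open Scope ereal_scope.

Lemma even_normal_moment k :
  \int[normal_prob (0 : R) 1]_x (x ^+ (2 * k))%:E = (gauss_moment R (2 * k))%:E.
Proof.
have ge0 j (x : R) : (0 <= x ^+ (2 * j))%R by rewrite exprM exprn_ge0// sqr_ge0.
have toR j : \int[normal_prob (0 : R) 1]_x (x ^+ (2 * j))%:E =
    2%:E * \int[mu]_(x in `[0%R, +oo[) (x ^+ (2 * j) * gauss_pdf x)%:E.
  rewrite integral_normal_prob//; last 2 first.
  - by apply/measurable_EFinP; exact: measurable_funX.
  - by move=> x; rewrite lee_fin.
  under eq_integral do rewrite -EFinM.
  rewrite ge0_symfun_integralT.
  - by congr (_ * integral _ _ _); apply/seteqP; split => x /=; rewrite in_itv/= andbT.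
  - by move=> x; rewrite mulr_ge0// gauss_pdf_ge0.
  - by move=> x; apply: cvgM; [exact: exprn_continuous|exact: continuous_gauss_pdf].
  - by move=> x /=; rewrite gauss_pdfN !exprM sqrrN.
elim: k => [|k IH].
  rewrite muln0/=; under eq_integral do rewrite expr0.
  by rewrite integral_cst//= probability_setT mul1e.
rewrite toR half_gauss_moment_rec muleCA -toR IH -EFinM.
by rewrite mulnS.
Qed.

Lemma std_normal_moment_even k :
  std_normal_moment R (2 * k) = (gauss_moment R (2 * k))%:E.
Proof. by rewrite /std_normal_moment unlock even_normal_moment. Qed.

(** The density is even and the Lebesgue measure is invariant under x |-> - x. *)
Lemma normal_probN (A : set R) : measurable A ->
  normal_prob (0 : R) 1 (-%R @^-1` A) = normal_prob (0 : R) 1 A.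
Proof.
move=> mA.
have densE (B : set R) : measurable B -> normal_prob (0 : R) 1 B =
    \int[mu]_x (\1_B x * gauss_pdf x)%:E.
  move=> mB; rewrite -[B in LHS]setIT -integral_indic// integral_normal_prob//.
  by apply/measurable_EFinP; exact: measurable_indic.
have mF : measurable_fun setT (fun x : R => (\1_A x * gauss_pdf x)%:E).
  apply/measurable_EFinP/measurable_funM; first exact: measurable_indic.
  exact: measurable_normal_pdf.
have mNA : measurable (-%R @^-1` A : set R).
  by rewrite -[X in measurable X]setTI; exact: (@oppr_measurable R setT).
rewrite !densE//.
transitivity (\int[pushforward mu (-%R : _ -> measurableTypeR R)]_x
    (\1_A x * gauss_pdf x)%:E).
  rewrite ge0_integral_pushforward//=; last first.
    by move=> x _; rewrite lee_fin mulr_ge0// gauss_pdf_ge0.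
  apply: eq_integral => x _; rewrite gauss_pdfN !indicE; congr ((_%:R * _)%:E).
apply: eq_measure_integral => B mB _; exact: lebesgue_measureN.
Qed.

Context d (T : measurableType d) (P : probability T R).
Implicit Types X : {RV P >-> R}.

(** |x^k| <= 1 + x^(2k). *)
Lemma integrable_power X k : \int[P]_w (X w ^+ (2 * k))%:E < +oo ->
  P.-integrable setT (fun w => (X w ^+ k)%:E).
Proof.
move=> X2k.
have mX j : measurable_fun setT (fun w => X w ^+ j)%R by exact: measurable_funX.
have i1 : P.-integrable setT (fun=> 1%:E) by exact: finite_measure_integrable_cst.
have i2 : P.-integrable setT (fun w => (X w ^+ (2 * k))%:E).
  apply/integrableP; split; first exact/measurable_EFinP.
  have ge0 w : (0 <= X w ^+ (2 * k))%R by rewrite exprM exprn_ge0// sqr_ge0.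
  by under eq_integral => w _ do rewrite /= (ger0_norm (ge0 w)).
apply: le_integrable (integrableD _ i1 i2) => //; first exact/measurable_EFinP.
move=> w _; rewrite /= lee_fin mulnC exprM.
have := sqr_ge0 (`|X w ^+ k| - 1)%R; rewrite sqrrB1 real_normK ?num_real// => h.
rewrite [leRHS]ger0_norm ?addr_ge0 ?sqr_ge0//.
have n0 : (0 <= `|X w ^+ k|)%R := normr_ge0 _; lra.
Qed.

Lemma odd_moment_symmetric X k : symmetric_rv X -> odd k ->
  P.-integrable setT (fun w => (X w ^+ k)%:E) -> \int[P]_w (X w ^+ k)%:E = 0.
Proof.
move=> symX ok iX.
have mk : measurable_fun setT (fun x : R => (x ^+ k)%:E).
  by apply/measurable_EFinP; exact: measurable_funX.
have EN : (fun w => (((- X)%R w) ^+ k)%:E) = (fun w => - (X w ^+ k)%:E).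
  apply/funext => w; rewrite -EFinN; congr EFin.
  by rewrite [(- X)%R w]/(- X w)%R exprNn -signr_odd ok expr1 mulN1r.
have H : \int[P]_w (X w ^+ k)%:E = \int[P]_w (((- X)%R w) ^+ k)%:E.
  rewrite -(@integral_distribution _ _ _ _ _ P X _ mk iX).
  rewrite -(@integral_distribution _ _ _ _ _ P (- X)%R _ mk)//; last first.
    by rewrite /comp EN; exact: integrableN.
  by apply: eq_measure_integral => A mA _; exact: symX.
move: H; rewrite EN integralN/=; last exact: integrable_add_def.
have := integrable_fin_num measurableT iX.
case: (\int[P]_w _) => // r _ [] h; congr EFin; lra.
Qed.

Lemma std_normal_symmetric X : std_normal_rv X -> symmetric_rv X.
Proof.
move=> nX A mA; have mNA : measurable (-%R @^-1` A : set R).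
  by rewrite -[X in measurable X]setTI; exact: (@oppr_measurable R setT).
transitivity (distribution P X A) => //.
by rewrite nX// -normal_probN// -nX.
Qed.

Lemma std_normal_rv_even_moment X k : std_normal_rv X ->
  \int[P]_w (X w ^+ (2 * k))%:E = (gauss_moment R (2 * k))%:E.
Proof.
move=> nX; rewrite -even_normal_moment.
rewrite (@integral_weighted _ _ T (measurableTypeR R) R P _ X (cst 1%R)) //.
- by apply: eq_integral => w _; rewrite /= mule1.
- exact: (@measurable_funPT _ _ _ _ X).
- move=> A mA; transitivity (distribution P X A); first by rewrite nX.
  have -> : distribution P X A = P (X @^-1` A) by [].
  rewrite -[X @^-1` A]setIT -integral_indic//; last exact: measurable_funPTI.
  by apply: eq_integral => w _; rewrite mulr1.
- by apply/measurable_EFinP; exact: measurable_funX.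
- by move=> x; rewrite lee_fin exprM exprn_ge0// sqr_ge0.
Qed.

Lemma gauss_moment_odd k : odd k -> gauss_moment R k = 0%R.
Proof.
elim/ltn_ind: k => -[|[|k]] IH//= ok; rewrite IH ?mulr0//.
by move: ok; rewrite negbK.
Qed.

End normal_moments.

(** * Existence of independent standard normal variables *)

Definition mk_rv d (T : measurableType d) (R : realType) (P : probability T R)
    (f : T -> R) (mf : measurable_fun setT f) : {RV P >-> R} :=
  mfun_Sub (mem_set mf).

Section iid_normals.
Variable R : realType.

(** The product rule for all indices suffices: indices outside the subfamily are
tested against the whole line. *)
Lemma full_independence d (T : measurableType d) (P : probability T R)
    (I : finType) (X : I -> {RV P >-> R}) :
  (forall A : I -> set R, (forall i, measurable (A i)) ->
    P (\bigcap_i (X i @^-1` A i)) = (\prod_i P (X i @^-1` A i))%E) ->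
  independent_family [set: I]%SET X.
Proof.
move=> full J A _ mA; pose B i := if i \in J then A i else setT.
have mB i : measurable (B i) by rewrite /B; case: ifP.
transitivity (P (\bigcap_i (X i @^-1` B i))).
  congr (P _); apply/seteqP; split => w h i /=.
    by move=> _; rewrite /B; case: ifP => // iJ; exact: h.
  by move=> iJ; have := h i Logic.I; rewrite /= /B iJ.
rewrite full// [RHS]big_mkcond; apply: eq_bigr => i _; rewrite /B.
by case: ifP => // _; rewrite preimage_setT probability_setT.
Qed.

(** Each step multiplies the space by a line that carries the normal law.  The
variables from rank N on are all equal to a last coordinate, which is then the one
that joins the independent ones. *)
Lemma iid_normals_nat (N : nat) :
  exists (d : measure_display) (T : measurableType d) (P : probability T R)
      (X : nat -> {RV P >-> R}),
    (forall k, std_normal_rv (X k)) /\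
    (forall A : nat -> set R, (forall k, measurable (A k)) ->
      P (\bigcap_(k < N) (X k @^-1` A k)) = (\prod_(k < N) P (X k @^-1` A k))%E).
Proof.
elim: N => [|N [d [T [P [X [nX iX]]]]]].
  exists _, (measurableTypeR R), (normal_prob (0 : R) 1),
    (fun=> mk_rv _ (@measurable_id _ (measurableTypeR R) setT)).
  split => [k A mA //|A mA].
  by rewrite big_ord0 bigcap_mkord big_ord0 probability_setT.
pose Q : probability (T * measurableTypeR R)%type R := (P \x normal_prob (0 : R) 1)%E.
have mfst k : measurable_fun setT (X k \o fst : T * measurableTypeR R -> R).
  by apply: measurableT_comp => //; exact: measurable_fst.
have msnd : measurable_fun setT (snd : T * measurableTypeR R -> R).
  exact: measurable_snd.
pose Y k : {RV Q >-> R} := if (k < N)%N then mk_rv Q (mfst k) else mk_rv Q msnd.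
exists _, (T * measurableTypeR R)%type, Q, Y.
have QX B C : measurable B -> measurable C ->
    Q (B `*` C) = (P B * normal_prob (0 : R) 1 C)%E.
  by move=> mB mC; exact: product_measure1E.
have Yfst k A : (k < N)%N -> Y k @^-1` A = (X k @^-1` A) `*` setT.
  by move=> kN; rewrite /Y kN; apply/seteqP; split => [[a b]|[a b] []].
have Ysnd k A : (N <= k)%N -> Y k @^-1` A = setT `*` A.
  by move=> kN; rewrite /Y ltnNge kN; apply/seteqP; split => [[a b]|[a b] []].
have mX k A : measurable A -> measurable (X k @^-1` A) by move=> mA; exact: measurable_funPTI.
have PY k A : measurable A -> (k < N)%N -> Q (Y k @^-1` A) = P (X k @^-1` A).
  move=> mA kN; rewrite Yfst// QX ?probability_setT ?mule1//; exact: mX.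
have PYN k A : measurable A -> (N <= k)%N -> Q (Y k @^-1` A) = normal_prob (0 : R) 1 A.
  by move=> mA kN; rewrite Ysnd// QX ?probability_setT ?mul1e.
split => [k A mA|A mA].
  have [kN|kN] := ltnP k N; last exact: PYN.
  by transitivity (P (X k @^-1` A)); [exact: PY|exact: nX].
rewrite big_ord_recr/= PYN//.
under eq_bigr => k _ do rewrite PY//.
have mB : measurable (\bigcap_(k < N) (X k @^-1` A k)).
  by apply: fin_bigcap_measurable => [|k _]; [exact: finite_II|exact: mX].
rewrite -iX// -(QX _ _ mB (mA N)).
congr (Q _); apply/seteqP; split => [[a b] h|[a b] [ha hb] k /=].
  split=> [k /= kN|].
    by have := h k (ltnW kN); rewrite Yfst// => -[].
  by have := h N (ltnSn N); rewrite Ysnd// => -[].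
rewrite ltnS leq_eqVlt => /orP[/eqP ->|kN].
  by suff : (Y N @^-1` A N) (a, b) by []; rewrite Ysnd.
suff : (Y k @^-1` A k) (a, b) by [].
by rewrite Yfst//; split => //; exact: ha.
Qed.

Lemma exists_iid_normals (I : finType) :
  exists (d : measure_display) (T : measurableType d) (P : probability T R)
      (g : I -> {RV P >-> R}),
    independent_family [set: I]%SET g /\ forall i, std_normal_rv (g i).
Proof.
have [d [T [P [X [nX iX]]]]] := iid_normals_nat #|I|.
exists d, T, P, (fun i => X (enum_rank i)); split => //.
apply: full_independence => A mA.
pose B (k : nat) : set R :=
  if (insub k : option 'I_#|I|) is Some j then A (enum_val j) else setT.
have BE (i : I) : B (enum_rank i) = A i by rewrite /B valK enum_rankK.
transitivity (P (\bigcap_(k < #|I|) (X k @^-1` B k))).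
  congr (P _); apply/seteqP; split => w h k /=.
    by move=> kI; have := h (enum_val (Ordinal kI)) Logic.I; rewrite /= -BE enum_valK.
  by move=> _; have := h (enum_rank k) (ltn_ord _); rewrite /= BE.
rewrite iX; last by move=> k; rewrite /B; case: insub.
rewrite (reindex (@enum_rank I))/=; last by exists enum_val => ? _; rewrite ?enum_rankK ?enum_valK.
by apply: eq_bigr => i _; rewrite BE.
Qed.

End iid_normals.

(** * Trace moments as sums over closed walks *)

Section bipartite.
Variables (R : realType) (n m : nat).
Local Notation V := ('I_n + 'I_m)%type.

Definition entry (M : 'M[R]_(n, m)) (e : V * V) : R :=
  match e with (inl i, inr j) => M i j | _ => 0 end.

Definition row_vertices : {set V} := [set v | if v is inl _ then true else false].

Definition edge_of (ij : 'I_n * 'I_m) : V * V := (inl ij.1, inr ij.2).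

Lemma edge_of_inj : injective edge_of.
Proof. by move=> [i j] [i' j'] [-> ->]. Qed.

Lemma entry_edge_of M ij : entry M (edge_of ij) = M ij.1 ij.2.
Proof. by []. Qed.

Lemma entry_off M e : (forall ij, e != edge_of ij) -> entry M e = 0.
Proof. by case: e => [[i|j] [i'|j']]//= /(_ (i, j')); rewrite eqxx. Qed.

Variable v0 : V.

Section trace.
Variable M : 'M[R]_(n, m).

Let walk_sum K u v : R := \sum_(s <- words V K.+1)
  (nth v0 s 0 == u)%:R * (nth v0 s K == v)%:R * \prod_(k < K) entry M (edge (nth v0 s) k).

Let step k z y : R := entry M (if odd k then (y, z) else (z, y)).

Let walk_sum0 u v : walk_sum 0 u v = (u == v)%:R.
Proof.
rewrite /walk_sum sum_wordsS sum_words0/= (bigD1 u)//= eqxx big_ord0 mulr1 mul1r.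
by rewrite big1 ?addr0// => y /negbTE ->; rewrite !mul0r.
Qed.

Let walk_sumS K u v : walk_sum K.+1 u v = \sum_z walk_sum K u z * step K z v.
Proof.
rewrite /walk_sum sum_wordsS.
under [RHS]eq_bigr do rewrite mulr_suml.
rewrite [RHS]exchange_big/= big_seq [RHS]big_seq; apply: eq_bigr => s /(@size_words _ K.+1) sK.
have nthr y i : (i <= K)%N -> nth v0 (rcons s y) i = nth v0 s i.
  by move=> iK; rewrite nth_rcons sK ltnS iK.
have lastr y : nth v0 (rcons s y) K.+1 = y by rewrite nth_rcons sK ltnn eqxx.
rewrite (bigD1 v)//= [X in _ + X]big1 ?addr0; last first.
  by move=> y /negbTE yv; rewrite lastr yv mulr0 mul0r.
rewrite [RHS](bigD1 (nth v0 s K))//= [X in _ = _ + X]big1 ?addr0; last first.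
  by move=> y; rewrite eq_sym => /negbTE ->; rewrite mulr0 !mul0r.
rewrite nthr// lastr !eqxx !mulr1 -mulrA; congr (_ * _).
rewrite big_ord_recr/=; congr (_ * _).
  apply: eq_bigr => k _; congr (entry M _).
  by rewrite /edge !nthr//; exact: ltnW.
by rewrite /step /edge lastr nthr.
Qed.

(** Two steps of the walk go from a row to a row and multiply by M M^T. *)
Let walk_sum_even p i :
  (forall i', walk_sum (2 * p) (inl i) (inl i') = ((M *m M^T) ^+ p) i i') /\
  (forall j, walk_sum (2 * p) (inl i) (inr j) = 0).
Proof.
elim: p => [|p [IHl IHr]].
  rewrite muln0 expr0; split => [i'|j]; rewrite walk_sum0//.
  by rewrite mxE; congr (_%:R).
have odd2 : odd (2 * p).+1 = true by rewrite /= oddM.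
have even2 : odd (2 * p) = false by rewrite oddM.
rewrite mulnS !addSn add0n; split => [i'|j].
  rewrite walk_sumS big_sumType/= [X in X + _]big1 ?add0r => [|l _]; last first.
    by rewrite /step odd2/= mulr0.
  rewrite exprSr mxE; transitivity (\sum_j \sum_l ((M *m M^T) ^+ p) i l * M l j * M i' j).
    apply: eq_bigr => j _; rewrite walk_sumS big_sumType/=.
    rewrite [X in _ + X]big1 ?addr0 => [|l _]; last by rewrite /step even2/= mulr0.
    rewrite mulr_suml; apply: eq_bigr => l _.
    by rewrite IHl /step odd2 even2.
  rewrite exchange_big/=; apply: eq_bigr => l _; rewrite mxE mulr_sumr.
  by apply: eq_bigr => j _; rewrite mxE mulrA.
rewrite walk_sumS big1// => z _; rewrite /step odd2/=.
by rewrite mulr0.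
Qed.

Lemma trace_walks p : \tr ((M *m M^T) ^+ p) =
  \sum_(s <- words V (2 * p).+1) (nth v0 s 0 \in row_vertices)%:R *
    ((nth v0 s (2 * p) == nth v0 s 0)%:R *
     \prod_(k < 2 * p) entry M (edge (nth v0 s) k)).
Proof.
rewrite /mxtrace; under eq_bigr => i _ do rewrite -(walk_sum_even p i).1.
rewrite exchange_big/=; apply: eq_bigr => s _.
rewrite -mulr_suml mulrA; congr (_ * _).
case: (nth v0 s 0) => [i|j]; last by rewrite big1 ?inE ?mul0r// => i _; rewrite mul0r.
rewrite inE mul1r (bigD1 i)//= eqxx mul1r big1 ?addr0// => l li.
by rewrite (_ : (inl i == inl l) = false) ?mul0r//; apply/eqP => -[il]; rewrite il eqxx in li.
Qed.

End trace.

Lemma big_edges (F : V * V -> R) : (forall e, (forall ij, e != edge_of ij) -> F e = 1) ->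
  \prod_e F e = \prod_ij F (edge_of ij).
Proof.
move=> F1; transitivity (\prod_(e in (edge_of @: predT)%SET) F e).
  rewrite (bigID (fun e => e \in (edge_of @: predT)%SET))/=.
  rewrite [X in _ * X]big1 ?mulr1// => e eN.
  by apply: F1 => ij; apply: contraNneq eN => ->; exact: imset_f.
by rewrite big_imset//; exact: in2W edge_of_inj.
Qed.

(** Pairs of vertices that do not join a row to a column do not occur in es, so
they contribute g 0 = 1. *)
Lemma product_moment_edges (g : nat -> R) (es : seq (V * V)) : g 0 = 1 ->
  (forall e, e \in es -> exists ij, e = edge_of ij) ->
  product_moment g es = \prod_ij g (count_mem (edge_of ij) es).
Proof.
move=> g0 es_edges; apply: big_edges => e eN.
rewrite (count_memPn _) ?g0//; apply/negP => /es_edges[ij eij].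
by have := eN ij; rewrite eij eqxx.
Qed.

Section moments.
Context d (T : measurableType d) (P : probability T R).
Variables (b : 'M[R]_(n, m)) (xi : 'I_n -> 'I_m -> {RV P >-> R}).
Hypothesis indep : independent_family [set: 'I_n * 'I_m]%SET (fun ij => xi ij.1 ij.2).
Hypothesis intX : forall i j k, P.-integrable setT (fun w => (xi i j w ^+ k)%:E).

Definition entry_moment (ij : 'I_n * 'I_m) (k : nat) : R :=
  fine (\int[P]_w (xi ij.1 ij.2 w ^+ k)%:E).

Let rm w := \matrix_(i, j) (b i j * xi i j w).

Let prod_entry w (es : seq (V * V)) : \prod_(e <- es) entry (rm w) e =
  (\prod_(e <- es) entry b e) *
  \prod_ij xi ij.1 ij.2 w ^+ count_mem (edge_of ij) es.
Proof.
elim: es => [|e es IH].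
  by rewrite !big_nil mul1r big1.
rewrite !big_cons IH.
have [/codomP[ij ->]|eN] := boolP (e \in codom edge_of); last first.
  rewrite !entry_off ?mul0r// => ij; apply: contraNneq eN => ->; exact: codom_f.
rewrite !entry_edge_of mxE.
rewrite [in RHS](bigD1 ij)//= eqxx add1n exprS (bigD1 ij)//=.
rewrite [in RHS](eq_bigr (fun kl => xi kl.1 kl.2 w ^+ count_mem (edge_of kl) es)).
  ring.
move=> kl klij; rewrite (_ : (edge_of ij == edge_of kl) = false)//.
by apply/negbTE; rewrite (inj_eq edge_of_inj) eq_sym.
Qed.

Lemma trace_moment_walks p : trace_moment P rm p =
  (\sum_(s <- words V (2 * p).+1) (nth v0 s 0 \in row_vertices)%:R *
    ((nth v0 s (2 * p) == nth v0 s 0)%:R * \prod_(k < 2 * p) entry b (edge (nth v0 s) k) *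
     \prod_ij entry_moment ij
        (count_mem (edge_of ij) [seq edge (nth v0 s) k | k <- iota 0 (2 * p)])))%:E.
Proof.
rewrite /trace_moment unlock.
pose es s : seq (V * V) := [seq edge (nth v0 s) k | k <- iota 0 (2 * p)].
pose c s : R := (nth v0 s 0 \in row_vertices)%:R *
  ((nth v0 s (2 * p) == nth v0 s 0)%:R * \prod_(k < 2 * p) entry b (edge (nth v0 s) k)).
pose Z s w : R := \prod_ij xi ij.1 ij.2 w ^+ count_mem (edge_of ij) (es s).
have EZ s := expectation_prod indep
  (f := fun ij x => x ^+ count_mem (edge_of ij) (es s))
  (fun ij => measurable_funX _ (@measurable_id _ _ _)) (fun ij => intX _ _ _).
transitivity (\int[P]_w (\sum_(s <- words V (2 * p).+1) ((c s)%:E * (Z s w)%:E)%E))%E.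
  apply: eq_integral => w _; rewrite trace_walks -sumEFin.
  apply: eq_bigr => s _; rewrite -EFinM /c /Z -!mulrA; congr (_ * (_ * _))%:E.
  have toes (F : V * V -> R) : \prod_(k < 2 * p) F (edge (nth v0 s) k) = \prod_(e <- es s) F e.
    by rewrite big_map -(big_mkord xpredT (fun k => F (edge (nth v0 s) k))) /index_iota subn0.
  by rewrite !toes prod_entry.
rewrite integral_sum//; last by move=> s; apply: integrableZl => //; exact: (EZ s).1.
rewrite -sumEFin; apply: eq_bigr => s _.
by rewrite (integralZl measurableT (EZ s).1) (EZ s).2 -EFinM /c -!mulrA.
Qed.

End moments.
End bipartite.

(** * Comparison with the Gaussian walk sum *)

Section class_moments.
Context (R : realType) (n m : nat) d (T : measurableType d) (P : probability T R).
Variables (xi : 'I_n -> 'I_m -> {RV P >-> R}).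
Hypothesis xi_sym : forall i j, symmetric_rv (xi i j).
Hypothesis xi_mom : forall i j p,
  ('E_P[fun w => (xi i j w ^+ (2 * p))%R] <= std_normal_moment R (2 * p))%E.

Lemma class_integrable i j k : P.-integrable setT (fun w => (xi i j w ^+ k)%:E).
Proof.
apply: integrable_power; have := xi_mom i j k.
by rewrite unlock std_normal_moment_even => /le_lt_trans; apply; rewrite ltry.
Qed.

Lemma class_moment_le ij k : 0 <= entry_moment xi ij k <= gauss_moment R k.
Proof.
rewrite /entry_moment; have [ok|ek] := boolP (odd k).
  by rewrite odd_moment_symmetric ?gauss_moment_odd ?lexx//; exact: class_integrable.
have -> : k = (2 * k./2)%N by rewrite mul2n even_halfK.
have ge0 : (0 <= \int[P]_w (xi ij.1 ij.2 w ^+ (2 * k./2))%:E)%E.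
  by apply: integral_ge0 => w _; rewrite lee_fin exprM exprn_ge0// sqr_ge0.
rewrite fine_ge0//= -lee_fin fineK; last first.
  by rewrite integrable_fin_num//; exact: class_integrable.
by have := xi_mom ij.1 ij.2 k./2; rewrite unlock std_normal_moment_even.
Qed.

End class_moments.

Section trace_comparison.
Variables (R : realType) (n m : nat).
Local Notation V := ('I_n + 'I_m)%type.
Variable v0 : V.
Context d (T : measurableType d) (P : probability T R).
Variables (b : 'M[R]_(n, m)) (xi : 'I_n -> 'I_m -> {RV P >-> R}).
Hypothesis indep : independent_family [set: 'I_n * 'I_m]%SET (fun ij => xi ij.1 ij.2).
Hypothesis xi_sym : forall i j, symmetric_rv (xi i j).
Hypothesis xi_mom : forall i j p,
  ('E_P[fun w => (xi i j w ^+ (2 * p))%R] <= std_normal_moment R (2 * p))%E.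
Let rm w := \matrix_(i, j) (b i j * xi i j w).
Let gaussian_trace p : R := walk_moment v0 (row_vertices n m) (gauss_moment R) (2 * p)
  (entry b) (iota 0 (2 * p)) [::].

Let edges_of_support (s : seq V) p :
  \prod_(k < 2 * p) entry b (edge (nth v0 s) k) != 0 ->
  forall e, e \in [seq edge (nth v0 s) k | k <- iota 0 (2 * p)] ->
    exists2 ij, e = edge_of ij & b ij.1 ij.2 != 0.
Proof.
move=> /prodf_neq0 nz e /mapP[k]; rewrite mem_iota add0n => /= kp ->.
have := nz (Ordinal kp) isT; move: (edge _ _) => [[i|?] [?|j]]/=; rewrite ?eqxx//.
by exists (i, j).
Qed.

(** All weights b are nonnegative and each moment is at most the Gaussian one, hence
the comparison holds walk by walk. *)
Lemma trace_moment_le_gaussian p : (forall i j, 0 <= b i j) ->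
  (trace_moment P rm p <= (gaussian_trace p)%:E)%E.
Proof.
move=> b0; have b0' e : 0 <= entry b e by case: e => -[i|?] [?|j] /=.
rewrite (trace_moment_walks v0 b indep (class_integrable xi_mom)) lee_fin.
apply: ler_sum => s _; rewrite /consistent/= andbT ler_wpM2l ?ler0n//.
have [->|nz] := eqVneq (\prod_(k < 2 * p) entry b (edge (nth v0 s) k)) 0.
  by rewrite mulr0 !mul0r.
rewrite ler_wpM2l ?mulr_ge0 ?ler0n ?prodr_ge0//.
rewrite product_moment_edges//; last first.
  by move=> e /(edges_of_support nz)[ij -> _]; exists ij.
by apply: ler_prod => ij _; exact: class_moment_le.
Qed.

(** An entry with b i j = 0 is never traversed by a walk of nonzero weight, so that
it enters through its moment of order 0, which is 1 for every law. *)
Lemma trace_moment_eq_gaussian p :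
  (forall i j, b i j != 0 -> std_normal_rv (xi i j)) ->
  trace_moment P rm p = (gaussian_trace p)%:E.
Proof.
move=> xi_normal.
rewrite (trace_moment_walks v0 b indep (class_integrable xi_mom)); congr EFin.
apply: eq_bigr => s _; rewrite /consistent/= andbT; congr (_ * _).
have [->|nz] := eqVneq (\prod_(k < 2 * p) entry b (edge (nth v0 s) k)) 0.
  by rewrite mulr0 !mul0r.
rewrite product_moment_edges//; last first.
  by move=> e /(edges_of_support nz)[ij -> _]; exists ij.
congr (_ * _); apply: eq_bigr => ij _.
have [bz|bnz] := eqVneq (b ij.1 ij.2) 0.
  rewrite (count_memPn _)/=.
    rewrite /entry_moment; under eq_integral do rewrite expr0.
    by rewrite integral_cst//= probability_setT mul1e.
  apply/negP => /(edges_of_support nz)[kl /edge_of_inj <-].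
  by rewrite bz eqxx.
move: (count_mem _ _) => k; rewrite /entry_moment.
have [ok|ek] := boolP (odd k).
  by rewrite odd_moment_symmetric ?gauss_moment_odd//; exact: class_integrable.
have -> : k = (2 * k./2)%N by rewrite mul2n even_halfK.
by rewrite std_normal_rv_even_moment//; exact: xi_normal.
Qed.

End trace_comparison.

Section independent_extension.
Context d (T : measurableType d) (R : realType) (P : probability T R).

(** Constants are independent of everything: each event about a null variable is
either empty or the whole space. *)
Lemma independent_family_cst0 (I : finType) (D : {set I}) (X : I -> {RV P >-> R}) :
  independent_family D X -> (forall i w, i \notin D -> X i w = 0) ->
  independent_family [set: I]%SET X.
Proof.
move=> indX X0 J A _ mA.
have X0E i : i \notin D -> X i @^-1` A i = if `[< A i 0 >] then setT else set0.
  move=> iD; apply/seteqP; case: asboolP => A0; split => w //=; rewrite X0//.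
have [[i /andP[iJ iD] A0]|all0] :
    (exists2 i, (i \in J) && (i \notin D) & ~ A i 0) \/
    (forall i, i \in J -> i \notin D -> A i 0).
  case: (pselect (forall i, i \in J -> i \notin D -> A i 0)); first by right.
  move=> /existsNP[i /not_implyP[iJ /not_implyP[iD A0]]]; left; exists i => //.
  by rewrite iJ.
- have Xi : X i @^-1` A i = set0 by rewrite X0E//; case: asboolP.
  rewrite (bigD1 i)//= Xi measure0 mul0e -[RHS](measure0 P); congr (P _).
  by apply/seteqP; split => w //= /(_ i iJ); rewrite Xi.
have X1 i : i \in J -> i \notin D -> X i @^-1` A i = setT.
  by move=> iJ iD; rewrite X0E//; case: asboolP => // -[]; exact: all0.
transitivity (P (\bigcap_(i in [set` (J :&: D)%SET]) (X i @^-1` A i))).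
  congr (P _); apply/seteqP; split => w h i /=.
    by rewrite inE => /andP[iJ _]; exact: h.
  move=> iJ; have [iD|iD] := boolP (i \in D); first by apply: h; rewrite /= inE iJ.
  suff : (X i @^-1` A i) w by [].
  by rewrite X1.
rewrite indX ?finset.subsetIr//.
rewrite [in RHS](big_setID D)/= [X in _ = (_ * X)%E]big1 ?mule1//.
by move=> i; rewrite inE => /andP[iD iJ]; rewrite X1// probability_setT.
Qed.

End independent_extension.

(** * The block-diagonal matrix *)

Lemma card_quotient_le N d q : (0 < d)%N -> (#|[set i : 'I_N | i %/ d == q]%SET| <= d)%N.
Proof.
move=> d0; pose f (i : 'I_N) : 'I_d := Ordinal (ltn_pmod i d0).
rewrite -[leqRHS]card_ord -(card_in_imset (f := f)) ?max_card//.
move=> i j; rewrite !inE => /eqP iq /eqP jq [ij]; apply/val_inj.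
by rewrite /= (divn_eq i d) (divn_eq j d) iq jq ij.
Qed.

Lemma card_quotient_ge N d q : (0 < d)%N -> (q.+1 * d <= N)%N ->
  (d <= #|[set i : 'I_N | i %/ d == q]%SET|)%N.
Proof.
move=> d0 qN.
have bound (t : 'I_d) : (q * d + t < N)%N.
  by apply: leq_trans qN; rewrite mulSn addnC ltn_add2r.
pose f (t : 'I_d) : 'I_N := Ordinal (bound t).
rewrite -[leqLHS]card_ord -(card_imset (f := f) predT); last first.
  by move=> s t [] /eqP; rewrite eqn_add2l => /eqP /val_inj.
apply/subset_leq_card/fintype.subsetP => _ /imsetP[t _ ->].
by rewrite inE /= divnMDl// divn_small// addn0.
Qed.

Section blocks.
Variables (R : realType) (n m d1 d2 : nat).
Hypotheses (d1_gt0 : (0 < d1)%N) (d2_gt0 : (0 < d2)%N) (d1_dvd_n : (d1 %| n)%N).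
Hypothesis blocks_fit : (n %/ d1 * d2 <= m)%N.
Local Notation V := ('I_n + 'I_m)%type.

Definition block_of (v : V) : nat :=
  match v with inl i => (i %/ d1)%N | inr j => (j %/ d2)%N end.

Lemma row_block_lt (i : 'I_n) : (i %/ d1 < n %/ d1)%N.
Proof. by rewrite ltn_divLR// divnK. Qed.

Lemma in_blockE (i : 'I_n) (j : 'I_m) : in_block d1 d2 i j = (i %/ d1 == j %/ d2)%N.
Proof.
have quo (k d x : nat) : (0 < d)%N -> (k * d <= x < k.+1 * d)%N = (x %/ d == k)%N.
  by move=> d0; rewrite eqn_leq leq_divRL// -[(x %/ d <= k)%N]ltnS ltn_divLR// andbC.
apply/existsP/eqP => [[k]|ij].
  by rewrite !quo// => /andP[/eqP -> /eqP ->].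
by exists (Ordinal (row_block_lt i)); rewrite !quo//= ij !eqxx.
Qed.

Definition block_mask : 'M[R]_(n, m) := \matrix_(i, j) (in_block d1 d2 i j)%:R.

Lemma entry_block_mask : entry block_mask = block_edge R (row_vertices n m) block_of.
Proof.
apply/funext => -[[i|i] [j|j]]; rewrite /block_edge/= ?mxE ?inE//.
by rewrite in_blockE.
Qed.

Lemma card_block_columns_ge (r : V) : r \in row_vertices n m ->
  (d2 <= #|[set v | (v \notin row_vertices n m) && (block_of v == block_of r)]%SET|)%N.
Proof.
case: r => [r _|r]; last by rewrite inE.
apply: leq_trans (card_quotient_ge (N := m) (q := (r %/ d1)%N) d2_gt0 _) _.
  by apply: leq_trans blocks_fit; rewrite leq_mul2r row_block_lt orbT.
rewrite -(card_imset _ (@inr_inj 'I_n 'I_m)); apply: subset_leq_card.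
by apply/fintype.subsetP => _ /imsetP[j + ->]; rewrite !inE.
Qed.

Lemma card_block_rows_ge (r : V) : r \in row_vertices n m ->
  (d1 <= #|[set u in row_vertices n m | block_of u == block_of r]%SET|)%N.
Proof.
case: r => [r _|r]; last by rewrite inE.
apply: leq_trans (card_quotient_ge (N := n) (q := (r %/ d1)%N) d1_gt0 _) _.
  by rewrite -[leqRHS](divnK d1_dvd_n) leq_mul2r row_block_lt orbT.
rewrite -(card_imset _ (@inl_inj 'I_n 'I_m)); apply: subset_leq_card.
by apply/fintype.subsetP => _ /imsetP[j + ->]; rewrite !inE.
Qed.

Lemma block_mask_col j : \sum_i block_mask i j ^+ 2 <= d1%:R.
Proof.
rewrite (eq_bigr (fun i : 'I_n => (i %/ d1 == j %/ d2)%N%:R)) => [|i _]; last first.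
  by rewrite mxE in_blockE -natrX; case: eqP.
rewrite -natr_sum ler_nat (leq_trans _ (card_quotient_le n (j %/ d2)%N d1_gt0))//.
rewrite -sum1_card [leqRHS]big_mkcond/=; apply: leq_sum => i _.
by rewrite inE; case: eqP.
Qed.

Lemma block_mask_row i : \sum_j block_mask i j ^+ 2 <= d2%:R.
Proof.
rewrite (eq_bigr (fun j : 'I_m => (j %/ d2 == i %/ d1)%N%:R)) => [|j _]; last first.
  by rewrite mxE in_blockE eq_sym -natrX; case: eqP.
rewrite -natr_sum ler_nat (leq_trans _ (card_quotient_le m (i %/ d1)%N d2_gt0))//.
rewrite -sum1_card [leqRHS]big_mkcond/=; apply: leq_sum => j _.
by rewrite inE; case: eqP.
Qed.

Lemma block_mask_max : (0 < n)%N -> (0 < m)%N ->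
  \big[Num.max/0]_(ij : 'I_n * 'I_m) block_mask ij.1 ij.2 ^+ 2 = 1.
Proof.
move=> n0 m0; apply/eqP; rewrite eq_le; apply/andP; split.
  apply/bigmax_leP; split => // ij _.
  by rewrite mxE -natrX; case: in_block.
apply: le_trans (le_bigmax _ _ (Ordinal n0, Ordinal m0)).
by rewrite mxE in_blockE /= !div0n expr1n.
Qed.

Section block_class.
Context d (T : measurableType d) (P : probability T R).
Variable g : 'I_n -> 'I_m -> {RV P >-> R}.
Hypothesis g_indep : independent_family [set ij | in_block d1 d2 ij.1 ij.2]%SET
  (fun ij : 'I_n * 'I_m => g ij.1 ij.2).
Hypothesis g_normal : forall i j, in_block d1 d2 i j -> std_normal_rv (g i j).

(** The class asks for a variable at every entry, also where b vanishes; the null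
variable is symmetric, has moments below the Gaussian ones and keeps the family
independent. *)
Definition padded_normal i j : {RV P >-> R} :=
  if in_block d1 d2 i j then g i j else mk_rv P (@measurable_cst _ _ T R setT 0).

Lemma padded_normal_indep :
  independent_family [set: 'I_n * 'I_m]%SET (fun ij => padded_normal ij.1 ij.2).
Proof.
apply: (@independent_family_cst0 _ _ _ _ _ [set ij | in_block d1 d2 ij.1 ij.2]%SET).
  move=> J A JD mA.
  have gE ij : ij \in J -> padded_normal ij.1 ij.2 = g ij.1 ij.2.
    by move=> /(fintype.subsetP JD); rewrite inE /padded_normal => ->.
  transitivity (\prod_(ij in J) P (g ij.1 ij.2 @^-1` A ij))%E; last first.
    by apply: eq_bigr => ij /gE ->.
  rewrite -g_indep//; congr (P _); apply: eq_bigcapr => ij /= ijJ.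
  by rewrite gE.
by move=> ij w; rewrite inE /padded_normal => /negbTE ->.
Qed.

Lemma padded_normal_sym i j : symmetric_rv (padded_normal i j).
Proof.
rewrite /padded_normal; case: ifPn => [ij|_ A mA].
  by apply: std_normal_symmetric; exact: g_normal.
by congr (P _); apply/seteqP; split => w; rewrite /= oppr0.
Qed.

Lemma padded_normal_moment i j p :
  ('E_P[fun w => (padded_normal i j w ^+ (2 * p))%R] <= std_normal_moment R (2 * p))%E.
Proof.
rewrite unlock /padded_normal std_normal_moment_even.
case: ifPn => [ij|_].
  by rewrite std_normal_rv_even_moment//; exact: g_normal.
have -> : (\int[P]_w (0 ^+ (2 * p))%:E = (0 ^+ (2 * p))%:E :> \bar R)%E.
  by rewrite integral_cst//= probability_setT mule1.
rewrite lee_fin; case: p => [|p]; first by rewrite muln0 expr0.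
rewrite (_ : 0 ^+ _ = 0); last by rewrite expr0n muln_eq0.
rewrite -lee_fin -even_normal_moment.
apply: integral_ge0 => x _; rewrite lee_fin exprM exprn_ge0// sqr_ge0//.
Qed.

Lemma block_matrixE w :
  \matrix_(i, j) (if in_block d1 d2 i j then g i j w else 0) =
  \matrix_(i, j) (block_mask i j * padded_normal i j w).
Proof.
apply/matrixP => i j; rewrite !mxE /padded_normal.
by case: ifP; rewrite ?mul1r ?mul0r.
Qed.

Lemma block_in_class : (0 < n)%N -> (0 < m)%N ->
  in_class P d1 d2
    (fun w => \matrix_(i, j) (if in_block d1 d2 i j then g i j w else 0)).
Proof.
move=> n0 m0; exists block_mask, padded_normal; split.
- exact: block_matrixE.
- by move=> i j; rewrite mxE ler0n.
- split; [exact: padded_normal_indep|exact: padded_normal_sym|].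
  exact: padded_normal_moment.
- split; first exact: block_mask_max.
    by apply/bigmax_leP; split => // j _; exact: block_mask_col.
  by apply/bigmax_leP; split => // i _; exact: block_mask_row.
Qed.

Lemma block_trace_moment (v0 : V) p :
  trace_moment P (fun w => \matrix_(i, j) (if in_block d1 d2 i j then g i j w else 0)) p =
  (walk_moment v0 (row_vertices n m) (gauss_moment R) (2 * p)
     (block_edge R (row_vertices n m) block_of) (iota 0 (2 * p)) [::])%:E.
Proof.
rewrite -entry_block_mask (funext block_matrixE).
rewrite (trace_moment_eq_gaussian v0 padded_normal_indep padded_normal_sym
  padded_normal_moment)// => i j.
rewrite mxE /padded_normal; case: ifP => [ij _|]; last by rewrite eqxx.
exact: g_normal.
Qed.

End block_class.

Lemma class_trace_moment_le (v0 : V) d (T : measurableType d) (P : probability T R)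
    (X : T -> 'M[R]_(n, m)) p : (0 < n)%N -> (0 < m)%N -> in_class P d1 d2 X ->
  (trace_moment P X p <= (walk_moment v0 (row_vertices n m) (gauss_moment R) (2 * p)
     (block_edge R (row_vertices n m) block_of) (iota 0 (2 * p)) [::])%:E)%E.
Proof.
move=> n0 m0 [b [xi [XE b0 [indep sym mom] [bmax bcol brow]]]].
rewrite (funext XE); apply: le_trans (trace_moment_le_gaussian v0 indep sym mom p b0) _.
rewrite lee_fin; apply: (@walk_moment_le _ _ _ _ _ _ _ _ d1 d2).
- by [].
- by [].
- by [].
- by case=> -[i|?] [?|j] /=.
- case=> -[i|?] [?|j] //=.
  rewrite -(@expr_le1 _ 2)// -bmax.
  exact: (le_bigmax _ (fun ij => b ij.1 ij.2 ^+ 2) (i, j)).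
- move=> [i|j]; rewrite big_sumType/= [X in X + _]big1 ?add0r => [|? _].
  + apply: le_trans brow.
    exact: (le_bigmax _ (fun i => \sum_(j < m) b i j ^+ 2) i).
  + by rewrite expr0n.
  + by rewrite big1// => ? _; rewrite expr0n.
  + by rewrite expr0n.
- move=> [i|j]; rewrite big_sumType/= [X in _ + X]big1 ?addr0 => [|? _].
  + by rewrite big1// => ? _; rewrite expr0n.
  + by rewrite expr0n.
  + apply: le_trans bcol.
    exact: (le_bigmax _ (fun j => \sum_(i < n) b i j ^+ 2) j).
  + by rewrite expr0n.
- by exists (inr (Ordinal m0)); rewrite inE.
- exact: card_block_columns_ge.
- exact: card_block_rows_ge.
- by rewrite oddM.
- by rewrite cats0.
Qed.

End blocks.

Theorem corollary1p9 (R : realType) (n m d1 d2 : nat)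
    (n_gt0 : (0 < n)%N) (m_gt0 : (0 < m)%N)
    (d1_gt0 : (0 < d1)%N) (d2_gt0 : (0 < d2)%N)
    (d1_dvd_n : (d1 %| n)%N)
    (ratio : n%:R / d1%:R <= m%:R / d2%:R :> R) :
  (exists (d : measure_display) (T : measurableType d) (P : probability T R)
          (Y : T -> 'M[R]_(n, m)), block_gaussian P d1 d2 Y) /\
  (forall (d : measure_display) (T : measurableType d) (P : probability T R)
          (Y : T -> 'M[R]_(n, m)),
     block_gaussian P d1 d2 Y ->
     in_class P d1 d2 Y /\
     (forall (d' : measure_display) (T' : measurableType d')
             (P' : probability T' R) (X : T' -> 'M[R]_(n, m)),
        in_class P' d1 d2 X ->
        forall p : nat, (trace_moment P' X p <= trace_moment P Y p)%E)).
Proof.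
split.
  have [d [T [P [g [g_indep g_normal]]]]] := exists_iid_normals R ('I_n * 'I_m)%type.
  exists d, T, P, (fun w => \matrix_(i, j) (if in_block d1 d2 i j then g (i, j) w else 0)).
  exists (fun i j => g (i, j)); split => [//| |i j _]; last exact: g_normal.
  have gE : (fun ij => g (ij.1, ij.2)) = g by apply/funext => -[].
  rewrite -gE in g_indep.
  by move=> J A _ mA; apply: g_indep => //; exact: finset.subsetT.
move=> d T P Y [g [YE g_indep g_normal]].
have blocks_fit : (n %/ d1 * d2 <= m)%N.
  move: ratio; rewrite ler_pdivlMr ?ltr0n// mulrAC ler_pdivrMr ?ltr0n//.
  rewrite -!natrM ler_nat -{1}(divnK d1_dvd_n) mulnAC => h.
  by rewrite -(leq_pmul2r d1_gt0).
rewrite (funext YE); split; first exact: block_in_class.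
move=> d' T' P' X XC p.
rewrite (block_trace_moment d1_gt0 d2_gt0 d1_dvd_n g_indep g_normal (inl (Ordinal n_gt0))).
exact: class_trace_moment_le.
Qed.
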